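(* There exists a universal numerical constant $C>0$ such that for every $n\geq 1$ and every function $f:\mathbb{R}^n\to\mathbb{R}$ which is smooth enough, namely $f\in\mathcal{C}^2(\mathbb{R}^n)$ with $f$ and all its partial derivatives up to order $2$ in $L^2(\gamma_n)$, $$\mathrm{Var}_{\gamma_n}(f)\leq\left|\int_{\mathbb{R}^n}\nabla f\,d\gamma_n\right|^2+C\sum_{i,j=1}^n\frac{\|\partial^2_{ij}f\|_2^2}{\left[1+\log\frac{\|\partial^2_{ij}f\|_2}{\|\partial^2_{ij}f\|_1}\right]^2}.$$
   Context: $\gamma_n$ is the standard Gaussian measure on $\mathbb{R}^n$, $\|\cdot\|_p$ is the norm of $L^p(\gamma_n)$, $\mathrm{Var}_{\gamma_n}(f)=\int f^2\,d\gamma_n-\left(\int f\,d\gamma_n\right)^2$, $|\cdot|$ is the Euclidean norm, and $\partial^2_{ij}f$ is the second order partial derivative of $f$ with respect to $x_i$ and $x_j$. A term of the sum with $\partial^2_{ij}f=0$ is interpreted as $0$. *)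

(* Defs.v *)
(* R^n is ['rV[R]_n], for an arbitrary [R : realType]. *)
From HB Require Import structures.
From mathcomp Require Import all_boot all_order all_algebra.
From mathcomp Require Import all_classical all_reals all_analysis.

Set Implicit Arguments.
Unset Strict Implicit.
Unset Printing Implicit Defensive.

Import Order.TTheory GRing.Theory Num.Theory.
Import numFieldNormedType.Exports.

Local Open Scope classical_set_scope.
Local Open Scope ring_scope.

(* The Borel sigma-algebra of R^n, as the product of the n copies of the Borel
   sigma-algebra of R. *)
Definition rV_display : measure_display.
Proof. exact: default_measure_display. Qed.

Section measurable_rV.
Context (R : realType) (n : nat).

Let coord_rV (i : 'I_n) (x : 'rV[R]_n) : measurableTypeR R := x 0 i.

Let rV_set0 : g_sigma_preimage coord_rV set0.
Proof. exact: sigma_algebra0. Qed.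

Let rV_setC A : g_sigma_preimage coord_rV A -> g_sigma_preimage coord_rV (~` A).
Proof. exact: sigma_algebraC. Qed.

Let rV_bigcup (F : (set 'rV[R]_n)^nat) :
  (forall i, g_sigma_preimage coord_rV (F i)) ->
  g_sigma_preimage coord_rV (\bigcup_i F i).
Proof. exact: sigma_algebra_bigcup. Qed.

HB.instance Definition _ := @isMeasurable.Build rV_display
  'rV[R]_n (g_sigma_preimage coord_rV) rV_set0 rV_setC rV_bigcup.

End measurable_rV.

Section gauss.
Context (R : realType).

Lemma measurable_coord_rV n (i : 'I_n) :
  measurable_fun [set: 'rV[R]_n] (fun x : 'rV[R]_n => x 0 i).
Proof.
move=> _ Y mY; rewrite setTI; apply: sub_sigma_algebra => /=.
rewrite -bigcup_seq/=; exists i => /=; first by rewrite mem_index_enum.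
by exists Y => //; rewrite setTI.
Qed.

Lemma measurable_fun_rVP d (T : measurableType d) n (f : T -> 'rV[R]_n) :
  (forall i, measurable_fun [set: T] (fun t => f t 0 i)) ->
  measurable_fun [set: T] f.
Proof.
move=> mf _ A; suff : g_sigma_preimage (fun i t => f t 0 i : measurableTypeR R)
    `<=` measurable.
  move=> + mA; apply.
  rewrite (@g_sigma_preimage_comp _ _ _ _
    (fun i (x : 'rV[R]_n) => x 0 i : measurableTypeR R) _ f).
  by exists A.
apply: smallest_sub; first exact: sigma_algebra_measurable.
rewrite -bigcup_seq => B [i _ [C mC <-]].
exact: mf.
Qed.

Definition cons_rV n (p : measurableTypeR R * 'rV[R]_n) : 'rV[R]_n.+1 :=
  \row_j (if unlift ord0 j is Some i then p.2 0 i else p.1).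

Lemma measurable_cons_rV n : measurable_fun setT (@cons_rV n).
Proof.
apply: measurable_fun_rVP => j.
under eq_fun do rewrite mxE.
case: (unlift ord0 j) => [i|]; last exact: measurable_fst.
exact: (measurableT_comp (measurable_coord_rV i) measurable_snd).
Qed.

HB.instance Definition _ n :=
  isMeasurableFun.Build _ _ _ _ (@cons_rV n) (@measurable_cons_rV n).

(* The n-fold product of the standard normal distribution N(0, 1). *)
Fixpoint gauss n : probability 'rV[R]_n R :=
  if n is m.+1 then
    distribution (normal_prob (0 : R) 1 \x gauss m)%E (@cons_rV m)
  else dirac (0 : 'rV[R]_0).

Lemma gauss_box n (A : 'I_n -> set R) : (forall i, measurable (A i)) ->
  gauss n [set x : 'rV[R]_n | forall i, A i (x 0 i)] =
  (\prod_(i < n) normal_prob (0 : R) 1 (A i))%E.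
Proof.
elim: n A => [|n ih] A mA.
  by rewrite big_ord0 /= diracE mem_set// => -[].
rewrite big_ord_recl -ih//=.
set B := [set x : 'rV[R]_n | forall i, A (lift ord0 i) (x 0 i)].
have mB : measurable B.
  rewrite (_ : B = \bigcap_(i in [set: 'I_n])
    ((fun x : 'rV[R]_n => x 0 i) @^-1` A (lift ord0 i))).
    apply: fin_bigcap_measurable => // i _.
    by rewrite -[X in measurable X]setTI; exact: measurable_coord_rV.
  by apply/seteqP; split => [x Ax i _|x Ax i]; exact: Ax.
rewrite -(product_measure1E (normal_prob (0 : R) 1) (gauss n) (mA ord0) mB).
congr ((normal_prob (0 : R) 1 \x gauss n)%E _).
apply/seteqP; split => -[a x] /=.
- move=> h; split; first by have := h ord0; rewrite mxE unlift_none.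
  by move=> i; have := h (lift ord0 i); rewrite mxE liftK.
- by move=> [a0 h] i; rewrite mxE; case: unliftP => [j ->|->].
Qed.

(* Real-valued L^p(gauss n) norm; [fine] is harmless on L^p functions, the only
   ones it is applied to. *)
Definition gauss_norm n (p : R) (f : 'rV[R]_n -> R) : R :=
  fine ('N[gauss n]_(p%:E)[EFin \o f])%E.

(* Hence [gauss_norm 2 g ^+ 2 / d] is 0 for [g = 0], whatever the denominator [d],
   even if [d] involves the junk quotient [0 / 0]. *)
Lemma gauss_norm0 n (p : R) : p != 0 -> @gauss_norm n p (cst 0) = 0.
Proof.
by move=> p0; rewrite /gauss_norm [X in Lnorm _ _ X](_ : _ = cst 0%E)// Lnorm0.
Qed.

Definition gauss_var n (f : 'rV[R]_n -> R) : R :=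
  \int[gauss n]_x (f x ^+ 2) - (\int[gauss n]_x f x) ^+ 2.

End gauss.

Section calculus.
Context (R : realType) (n : nat).
Implicit Types (f : 'rV[R]_n -> R) (i j : 'I_n).

Definition partial i f (x : 'rV[R]_n) : R := 'D_(delta_mx 0 i) f x.

Definition partial2 i j f : 'rV[R]_n -> R := partial i (partial j f).

Definition gradient f (x : 'rV[R]_n) : 'rV[R]_n := \row_i partial i f x.

Fixpoint Ck (k : nat) f : Prop :=
  continuous f /\
  if k is m.+1 then
    forall i, (forall x, derivable f x (delta_mx 0 i)) /\ Ck m (partial i f)
  else True.

(* The norm of ['rV[R]_n] in the library is the sup norm. *)
Definition euclidean_norm (x : 'rV[R]_n) : R := Num.sqrt (\sum_i x 0 i ^+ 2).

Definition gauss_integral_rV (F : 'rV[R]_n -> 'rV[R]_n) : 'rV[R]_n :=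
  \row_i \int[gauss R n]_x (F x 0 i).

End calculus.

(* Main.v *)
Require Import Defs.
From HB Require Import structures.
From mathcomp Require Import all_boot all_order all_algebra.
From mathcomp Require Import all_classical all_reals all_analysis.
From mathcomp Require Import measurable_realfun ring lra.
Import Order.TTheory GRing.Theory Num.Theory.
Import numFieldNormedType.Exports.
Set Implicit Arguments.
Unset Strict Implicit.
Unset Printing Implicit Defensive.
Local Open Scope classical_set_scope.
Local Open Scope ring_scope.

(** The proof uses the Wiener chaos decomposition and no semigroup. Let
    [raise i F = x_i F - d_i F] be the adjoint of [d_i] in [L^2] of the Gaussian
    measure ([E_partial_raise], from the integration by parts formula
    [gauss_ibp]), and let the chaos of order [k] consist of the polynomials [F]
    with [sum_i raise i (d_i F) = k F]. The Hermite polynomials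
    [raise i_1 (... (raise i_k 1))] span it. Since
    [E(d_i f * H) = E(f * raise i H)], the energy [a_k f] of [f] in the chaos of
    order [k] satisfies [sum_i a_k (d_i f) = (k + 1) a_(k+1) f]
    ([energy_partial]). Thus [a_0 f] is the square of the mean, [a_1 f] is
    [|E (grad f)|^2], and
    [a_(k+2) f = sum_(i,j) a_k (d_ij f) / ((k + 1) (k + 2))]. As polynomials are
    dense in [L^2] ([polyfun_dense]), the energies add up to [E(f^2)]
    ([energy_approx]), and it remains to bound
    [sum_k a_k g / ((k + 1) (k + 2))] for each second derivative [g]
    ([talagrand_energy]).

    The logarithm comes from hypercontractivity, of which only the following
    case is used: [E(F^4)^(1/2) <= 3^k E(F^2)] on the chaos of order [k]
    ([chaos_hypercontractive]). By Cauchy-Schwarz it implies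
    [a_k g <= 3^k ||g||_1 ||g||_2] ([energy_low_degree]). Put
    [L = log (||g||_2 / ||g||_1)]. For [k] below [L / 4], these bounds sum to at
    most a constant times [||g||_2^2 e^(-L/2)]; for larger [k], the weights are
    [O(1 / (1 + L)^2)] while Bessel's inequality bounds the sum of the [a_k g] by
    [||g||_2^2] ([weighted_sum_bound]).

    Density is obtained from the algebra of bounded functions [u] such that
    [u p] is an [L^2] limit of polynomials for every polynomial [p]. It is closed
    under bounded pointwise limits, so that the sets whose indicator belongs to
    it form a sigma-algebra. It contains Gaussian bumps in one coordinate, by
    Taylor expansion, and hence the indicators of half-spaces orthogonal to the
    axes. *)

(** * Expectations of integrable and square-integrable functions *)

Section expectation.
Context d (T : measurableType d) (R : realType) (P : probability T R).
Implicit Types (f g h : T -> R) (c : R).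

Definition intg f := P.-integrable [set: T] (EFin \o f).

Definition sqintg f := measurable_fun [set: T] f /\ intg (fun x => f x ^+ 2).

Local Notation E f := (\int[P]_x f x).

Lemma eq_intg f g : f =1 g -> intg f -> intg g.
Proof. by move=> /funext ->. Qed.

Lemma eq_sqintg f g : f =1 g -> sqintg f -> sqintg g.
Proof. by move=> /funext ->. Qed.

Lemma eq_E f g : f =1 g -> E f = E g.
Proof. by move=> /funext ->. Qed.

Lemma intg_le f g : measurable_fun [set: T] f -> intg g ->
  (forall x, `|f x| <= g x) -> intg f.
Proof.
move=> mf ig fg; apply: (le_integrable measurableT _ _ ig).
  exact/measurable_EFinP.
by move=> x _ /=; rewrite lee_fin (le_trans (fg x))// ler_norm.
Qed.

Lemma intg_cst c : intg (cst c).
Proof. exact: finite_measure_integrable_cst. Qed.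

Lemma intgD f g : intg f -> intg g -> intg (fun x => f x + g x).
Proof. by move=> jf jg; have := integrableD measurableT jf jg. Qed.

Lemma intgZ c f : intg f -> intg (fun x => c * f x).
Proof. by move=> jf; have := integrableZl measurableT c jf. Qed.

Lemma intgB f g : intg f -> intg g -> intg (fun x => f x - g x).
Proof. by move=> jf jg; have := integrableB measurableT jf jg. Qed.

Lemma intg_sum I (s : seq I) (F : I -> T -> R) :
  (forall i, intg (F i)) -> intg (fun x => \sum_(i <- s) F i x).
Proof.
move=> iF; elim: s => [|a s ih].
  by apply: eq_intg (intg_cst 0) => x; rewrite big_nil.
by apply: eq_intg (intgD (iF a) ih) => x; rewrite big_cons.
Qed.

Lemma E_cst c : E (cst c) = c.
Proof.
have -> : cst c = (fun=> c) by [].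
by rewrite Rintegral_cst//; have /= -> := probability_setT P; rewrite mulr1.
Qed.

Lemma ED f g : intg f -> intg g -> E (fun x => f x + g x) = E f + E g.
Proof. by move=> jf jg; rewrite RintegralD. Qed.

Lemma EB f g : intg f -> intg g -> E (fun x => f x - g x) = E f - E g.
Proof. by move=> jf jg; rewrite RintegralB. Qed.

Lemma EZ c f : intg f -> E (fun x => c * f x) = c * E f.
Proof. by move=> jf; rewrite RintegralZl. Qed.

Lemma E_sum I (s : seq I) (F : I -> T -> R) : (forall i, intg (F i)) ->
  E (fun x => \sum_(i <- s) F i x) = \sum_(i <- s) E (F i).
Proof.
move=> iF; elim: s => [|a s ih].
  by rewrite big_nil -[RHS](E_cst 0); apply: eq_E => x; rewrite big_nil.
rewrite big_cons -ih -ED//; last exact: intg_sum.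
by apply: eq_E => x; rewrite big_cons.
Qed.

Lemma E_ge0 f : (forall x, 0 <= f x) -> 0 <= E f.
Proof. by move=> f0; apply: Rintegral_ge0. Qed.

Lemma le_E f g : intg f -> intg g -> (forall x, f x <= g x) -> E f <= E g.
Proof. by move=> jf jg fg; apply: le_Rintegral. Qed.

Lemma intg_mul f g : sqintg f -> sqintg g -> intg (fun x => f x * g x).
Proof.
move=> [mf jf] [mg jg]; apply: (@intg_le _ (fun x => f x ^+ 2 + g x ^+ 2)).
- exact: measurable_funM.
- exact: intgD.
- move=> x; rewrite normrM.
  have := sqr_ge0 (`|f x| - `|g x|); have := sqr_ge0 (`|f x| + `|g x|).
  rewrite -(real_normK (num_real (f x))) -(real_normK (num_real (g x))); nra.
Qed.

Lemma sqintg_cst c : sqintg (cst c).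
Proof. by split => //; exact: intg_cst (c ^+ 2). Qed.

Lemma sqintg_intg f : sqintg f -> intg f.
Proof.
move=> jf; apply: eq_intg (intg_mul jf (sqintg_cst 1)) => x.
by rewrite mulr1.
Qed.

Lemma sqintgZ c f : sqintg f -> sqintg (fun x => c * f x).
Proof.
move=> [mf jf]; split; first exact: measurable_funM.
by apply: eq_intg (intgZ (c ^+ 2) jf) => x; rewrite exprMn.
Qed.

Lemma sqintgD f g : sqintg f -> sqintg g -> sqintg (fun x => f x + g x).
Proof.
move=> jf jg; have [mf if2] := jf; have [mg ig2] := jg.
split; first exact: measurable_funD.
apply: eq_intg (intgD (intgD if2 ig2) (intgZ 2 (intg_mul jf jg))) => x; ring.
Qed.

Lemma sqintgB f g : sqintg f -> sqintg g -> sqintg (fun x => f x - g x).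
Proof.
move=> jf jg; apply: eq_sqintg (sqintgD jf (sqintgZ (-1) jg)) => x; ring.
Qed.

Lemma sqintg_sum I (s : seq I) (F : I -> T -> R) :
  (forall i, sqintg (F i)) -> sqintg (fun x => \sum_(i <- s) F i x).
Proof.
move=> iF; elim: s => [|a s ih].
  by apply: eq_sqintg (sqintg_cst 0) => x; rewrite big_nil.
by apply: eq_sqintg (sqintgD (iF a) ih) => x; rewrite big_cons.
Qed.

Lemma sqintg_le f g : measurable_fun [set: T] f -> sqintg g ->
  (forall x, `|f x| <= g x) -> sqintg f.
Proof.
move=> mf [mg jg] fg; split => //.
apply: intg_le jg _; first exact: measurable_funX.
by move=> x; rewrite normrX lerXn2r ?nnegrE// (le_trans _ (fg x)).
Qed.

Lemma sqintg_norm f : sqintg f -> sqintg (fun x => `|f x|).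
Proof.
move=> [mf jf]; split; first exact: measurableT_comp.
by apply: eq_intg jf => x; rewrite real_normK// num_real.
Qed.

(** The quadratic polynomial [E ((t f - g)^2)] in [t] is nonnegative. *)
Lemma E_cauchy_schwarz f g : sqintg f -> sqintg g ->
  E (fun x => f x * g x) ^+ 2 <= E (fun x => f x ^+ 2) * E (fun x => g x ^+ 2).
Proof.
move=> jf jg.
set a := E (fun x => f x ^+ 2); set b := E (fun x => f x * g x).
set c := E (fun x => g x ^+ 2).
have quad t : 0 <= a * t ^+ 2 - 2 * t * b + c.
  have -> : a * t ^+ 2 - 2 * t * b + c = E (fun x => (t * f x - g x) ^+ 2).
    have -> : E (fun x => (t * f x - g x) ^+ 2) =
      E (fun x => t ^+ 2 * f x ^+ 2 + ((- 2 * t) * (f x * g x) + g x ^+ 2)).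
      by apply: eq_E => x; ring.
    have ifg := intg_mul jf jg; have [_ if2] := jf; have [_ ig2] := jg.
    rewrite ED; [|exact: intgZ|by apply: intgD => //; exact: intgZ].
    rewrite ED; [|exact: intgZ|by []].
    by rewrite !EZ// /a /b /c; ring.
  by apply: E_ge0 => x; exact: sqr_ge0.
have a0 : 0 <= a by apply: E_ge0 => x; exact: sqr_ge0.
have [a_eq0|a_neq0] := eqVneq a 0.
  have [->|b0] := eqVneq b 0; first by rewrite expr0n/= a_eq0 mul0r.
  (* if [E (f^2) = 0], this [t] would make the affine bound equal to [-1] *)
  have := quad ((c + 1) / (2 * b)).
  rewrite a_eq0 mul0r add0r => h.
  have e : 2 * ((c + 1) / (2 * b)) * b = c + 1 by field.
  by move: h; rewrite e; lra.
have a_gt0 : 0 < a by rewrite lt_neqAle eq_sym a_neq0.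
have := quad (b / a).
have -> : a * (b / a) ^+ 2 - 2 * (b / a) * b + c = (a * c - b ^+ 2) / a by field.
by rewrite pmulr_lge0 ?invr_gt0// subr_ge0.
Qed.

Lemma E_sqr_le f : sqintg f -> E f ^+ 2 <= E (fun x => f x ^+ 2).
Proof.
move=> jf; have := E_cauchy_schwarz jf (sqintg_cst 1).
rewrite (_ : E (fun x => (cst 1 x) ^+ 2) = 1); last first.
  by rewrite -[RHS](E_cst 1); apply: eq_E => x /=; rewrite expr1n.
by rewrite mulr1; under eq_E do rewrite mulr1.
Qed.

Lemma dominated_E (f_ : nat -> T -> R) f g :
  (forall k, measurable_fun [set: T] (f_ k)) -> measurable_fun [set: T] f ->
  intg g -> (forall k x, `|f_ k x| <= g x) ->
  (forall x, f_ ^~ x @ \oo --> f x) ->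
  (fun k => E (f_ k)) @ \oo --> E f.
Proof.
move=> mf_ mf ig fg cf.
have [|||||i1 i2 i3] := @dominated_convergence _ T R P setT measurableT
  (fun k => EFin \o f_ k) (EFin \o f) (EFin \o g).
- by move=> k; apply/measurable_EFinP.
- exact/measurable_EFinP.
- by apply/aeW => x _; apply/fine_cvgP; split; [exact: nearW|exact: cf].
- exact: ig.
- by apply/aeW => x k _; rewrite /= lee_fin.
have fE : (\int[P]_x (EFin \o f) x)%E \is a fin_num.
  exact: integrable_fin_num.
rewrite /Rintegral.
apply: fine_cvg; rewrite fineK//; exact: i3.
Qed.

(** Dominated convergence in [L^2], phrased as an approximation statement: this
    is the only way in which limits of functions enter the density theorem. *)
Lemma dominated_sqE (f_ : nat -> T -> R) f g :
  (forall k, measurable_fun [set: T] (f_ k)) -> measurable_fun [set: T] f ->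
  sqintg g -> (forall k x, `|f_ k x| <= g x) ->
  (forall x, f_ ^~ x @ \oo --> f x) ->
  forall e, 0 < e -> exists k, E (fun x => (f x - f_ k x) ^+ 2) < e.
Proof.
move=> mf_ mf [mg jg] fg cf e e0.
have fleg x : `|f x| <= g x.
  have nf : (fun k => `|f_ k x|) @ \oo --> `|f x| by exact: cvg_norm (cf x).
  by rewrite -(cvg_lim _ nf)//; apply: limr_le;
    [apply/cvg_ex; eexists; exact: nf|exact: nearW].
have : (fun k => E (fun x => (f x - f_ k x) ^+ 2)) @ \oo --> E (cst 0).
  apply: (@dominated_E _ _ (fun x => 4 * g x ^+ 2)).
  - by move=> k; apply: measurable_funX; exact: measurable_funB.
  - exact: measurable_cst.
  - exact: intgZ.
  - move=> k x; rewrite normrX.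
    have : `|f x - f_ k x| <= 2 * g x.
      by rewrite (le_trans (ler_normB _ _))// mulr2n mulrDl mul1r lerD.
    rewrite -(ler_pXn2r (n := 2)) ?nnegrE//.
      by rewrite exprMn -natrX.
    by rewrite mulr_ge0// (le_trans _ (fleg x)).
  - move=> x; rewrite /= -[X in _ --> X](expr0n _ 2) -(subrr (f x)).
    rewrite !expr2.
    under eq_fun do rewrite expr2.
    by apply: cvgM; apply: cvgB => //; exact: cvg_cst.
rewrite E_cst => /cvgrPdist_lt/(_ e e0)[N _ /(_ N (leqnn N))/=].
rewrite sub0r normrN ger0_norm; first by exists N.
by apply: E_ge0 => x; exact: sqr_ge0.
Qed.

End expectation.

(** * Integration by parts on the line *)

Section normal.
Context (R : realType).
Local Notation mu := (@lebesgue_measure R).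
Local Notation gamma := (@normal_prob R 0 1).
Local Notation phi := (@normal_pdf R 0 1).

(** [normal_pdf] is a Radon-Nikodym density of [normal_prob]: both have the same
    integral over every measurable set. *)
Lemma ge0_integral_normal (f : R -> \bar R) :
  measurable_fun [set: R] f -> (forall x, 0 <= f x)%E ->
  (\int[gamma]_x f x = \int[mu]_x (f x * (phi x)%:E))%E.
Proof.
move=> mf f0; have dom := @normal_prob_dominates R 0 1.
rewrite -(Radon_Nikodym_SigmaFinite.change_of_variables dom)//.
have idens := Radon_Nikodym_SigmaFinite.f_integrable dom.
apply: ae_eq_integral => //.
- by apply: emeasurable_funM => //; exact: measurable_int idens.
- apply: emeasurable_funM => //.
  by apply/measurable_EFinP; exact: measurable_normal_pdf.
- apply: ae_eqe_mul2l; apply: integral_ae_eq => //.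
  + by apply/measurable_EFinP; exact: measurable_normal_pdf.
  + by move=> A _ mA; rewrite -Radon_Nikodym_SigmaFinite.f_integral.
Qed.

Lemma integrable_normal (f : R -> R) : gamma.-integrable setT (EFin \o f) ->
  mu.-integrable setT (fun x => (f x * phi x)%:E).
Proof.
move=> /integrableP[mf fy]; apply/integrableP; split.
  apply/measurable_EFinP; apply: measurable_funM; first exact/measurable_EFinP.
  exact: measurable_normal_pdf.
rewrite ge0_integral_normal// in fy; last exact: measurableT_comp.
rewrite (_ : (\int[mu]_x _)%E =
  (\int[mu]_x (`|(EFin \o f) x| * (phi x)%:E))%E)//.
by apply: eq_integral => x _; rewrite /= normrM (ger0_norm (normal_pdf_ge0 _ _ _)).
Qed.

Lemma integral_normal (f : R -> R) : gamma.-integrable setT (EFin \o f) ->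
  (\int[gamma]_x (f x)%:E = \int[mu]_x (f x * phi x)%:E)%E.
Proof.
move=> jf; rewrite integralE [RHS]integralE.
have mf := measurable_int _ jf.
rewrite !ge0_integral_normal//; [|exact: measurable_funeneg|exact: measurable_funepos].
congr (_ - _)%E; apply: eq_integral => x _.
- rewrite !funeposE /= maxe_pMl ?mul0e ?lee_fin ?normal_pdf_ge0//.
- rewrite !funenegE /= maxe_pMl ?mul0e ?lee_fin ?normal_pdf_ge0//.
  by rewrite -EFinM mulNr.
Qed.

(** Boundary terms at infinity are avoided by a cutoff: the fundamental theorem
    of calculus on [[-N, N]] for [w x * (1 - (x / N)^2)], which vanishes at both
    ends, gives a zero integral for every [N], and its derivative tends to [w']
    while being dominated by [|w'| + 2 |w|]. *)
Lemma integral_derivative_eq0 (w w' : R -> R) :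
  (forall x : R, is_derive x (1 : R) w (w' x)) -> continuous w' ->
  mu.-integrable setT (EFin \o w) -> mu.-integrable setT (EFin \o w') ->
  (\int[mu]_x (w' x)%:E = 0)%E.
Proof.
move=> dw cw' iw iw'.
have mw : measurable_fun [set: R] w.
  by apply/measurable_EFinP; exact: measurable_int iw.
have mw' : measurable_fun [set: R] w'.
  by apply/measurable_EFinP; exact: measurable_int iw'.
have cw : continuous w.
  by move=> x; apply: differentiable_continuous; apply/derivable1_diffP; case: (dw x).
pose N (n : nat) : R := n.+1%:R.
pose f_ n x := w' x * (1 - (x / N n) ^+ 2) + w x * (- (2 * x / N n ^+ 2)).
pose f n := f_ n \_ `[- N n, N n].
have N0 n : 0 < N n by rewrite ltr0n.
have df n (x : R) : is_derive x (1 : R) (fun x => w x * (1 - (x / N n) ^+ 2)) (f_ n x).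
  have dwx := dw x.
  apply: is_derive_eq.
  rewrite /f_ /GRing.scale/=.
  have := N0 n; move: (N n) => M M0.
  by field; rewrite gt_eqF.
have cf n : continuous (f_ n).
  move=> x; apply: cvgD; apply: cvgM; [exact: cw'| |exact: cw|].
  - apply: cvgB; first exact: cvg_cst.
    by apply: cvgM; apply: cvgM;
      [exact: cvg_id|exact: cvg_cst|exact: cvg_id|exact: cvg_cst].
  - apply: cvgN; apply: cvgM; last exact: cvg_cst.
    by apply: cvgM; [exact: cvg_cst|exact: cvg_id].
have intf n : (\int[mu]_x (f n x)%:E = 0)%E.
  transitivity (\int[mu]_(x in `[(- N n)%R, (N n)%R]) (f_ n x)%:E)%E.
    by rewrite [RHS]integral_mkcond/=; under [RHS]eq_integral do rewrite restrict_EFin.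
  rewrite (@continuous_FTC2 _ (f_ n) (fun x => w x * (1 - (x / N n) ^+ 2))).
  - by rewrite mulNr sqrrN divff ?gt_eqF// expr1n subrr !mulr0 subee.
  - by rewrite -subr_gt0 opprK addr_gt0.
  - by apply: continuous_subspaceT; exact: cf.
  - have cF : continuous (fun x => w x * (1 - (x / N n) ^+ 2)).
      move=> x; apply: differentiable_continuous; apply/derivable1_diffP.
      by case: (df n x).
    split.
    + by move=> x _; case: (df n x).
    + exact/cvg_at_right_filter/cF.
    + exact/cvg_at_left_filter/cF.
  - by move=> x _; rewrite derive1E; case: (df n x).
have [|||||_ _] := @dominated_convergence _ _ R mu setT measurableT
  (fun n => EFin \o f n) (EFin \o w') (fun x => (`|w' x| + 2 * `|w x|)%:E).
- move=> n; apply/measurable_EFinP; apply/(measurable_restrictT _ _).1 => //.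
  by apply: measurable_funTS; apply: continuous_measurable_fun; exact: cf.
- exact/measurable_EFinP.
- apply/aeW => x _; apply/fine_cvgP; split; first exact: nearW.
  have cfx : f_ ^~ x @ \oo --> w' x.
    have h0 : (fun n => x / N n) @ \oo --> (0 : R).
      rewrite -[X in _ --> X](mulr0 x); apply: cvgM; first exact: cvg_cst.
      exact: cvg_harmonic.
    have h1 : (fun n => (N n)^-1) @ \oo --> (0 : R) by exact: cvg_harmonic.
    rewrite -[X in _ --> X]addr0; apply: cvgD.
      rewrite -[X in _ --> X]mulr1; apply: cvgM; first exact: cvg_cst.
      rewrite -[X in _ --> X]subr0; apply: cvgB; first exact: cvg_cst.
      rewrite -[X in _ --> X](mulr0 0).
      exact: cvgM.
    rewrite -[X in _ --> X](mulr0 (w x)); apply: cvgM; first exact: cvg_cst.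
    rewrite -oppr0; apply: cvgN.
    rewrite (_ : (fun n => 2 * x / N n ^+ 2) =
                 (fun n => (2 * (x / N n)) * (N n)^-1)); last first.
      by apply/funext => n; rewrite expr2 invfM; ring.
    rewrite -[X in _ --> X](mulr0 (2 * 0)); apply: cvgM => //.
    by apply: cvgM => //; exact: cvg_cst.
  apply: cvg_trans cfx; apply: near_eq_cvg; near=> n.
  rewrite /= /f patchE mem_set//= in_itv/=.
  rewrite -ler_norml; near: n.
  exists (Num.bound `|x|) => // n /= xn.
  apply: (le_trans (ltW (archi_boundP _ )) _) => //.
  by rewrite ler_nat (leq_trans xn).
- have iw'n := integrable_norm iw'.
  have iwn := integrable_norm iw.
  have := integrableD measurableT iw'n (integrableZl measurableT 2 iwn).
  by apply: eq_integrable => // x _ /=; rewrite EFinD EFinM.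
- apply/aeW => x n _; rewrite lee_fin /f patchE; case: ifPn => [|_]; last first.
    by rewrite normr0 addr_ge0// mulr_ge0.
  rewrite inE/= in_itv/= -ler_norml => xN.
  have a1 : `|x / N n| <= 1.
    by rewrite normrM normfV (gtr0_norm (N0 n)) ler_pdivrMr// mul1r.
  have N1 : `|(N n)^-1| <= 1 by rewrite normfV (gtr0_norm (N0 n)) invf_le1// ler1n.
  rewrite (le_trans (ler_normD _ _))// !normrM lerD//.
    rewrite ler_piMr// ler_norml; move: a1; rewrite ler_norml => /andP[].
    have := sqr_ge0 (x / N n); rewrite expr2; move: (x / N n) => z z2 z1 z0.
    by apply/andP; split; nra.
  rewrite mulrC ler_wpM2r//.
  rewrite normrN (_ : 2 * x / N n ^+ 2 = 2 * ((x / N n) * (N n)^-1)); last first.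
    by rewrite expr2 invfM; ring.
  rewrite 2!normrM (ger0_norm (_ : 0 <= 2))// ler_piMr//.
  by rewrite mulr_ile1.
under eq_fun do rewrite /= intf.
by move=> /cvg_lim <-//; rewrite lim_cst.
Unshelve. all: by end_near. Qed.

Lemma is_derive_normal_pdf (x : R) : is_derive x (1 : R) phi (- x * phi x).
Proof.
have -> : phi = (fun x => normal_peak 1 * expR (- 2^-1 * x ^+ 2)).
  apply/funext => y; rewrite normal_pdfE ?oner_neq0//= /normal_fun.
  by congr (_ * expR _); rewrite subr0 expr1n; field.
have dsq : is_derive x (1 : R) (fun x : R => - 2^-1 * x ^+ 2) (- x).
  by apply: is_derive_eq; rewrite /GRing.scale/=; field.
have dexp : is_derive x (1 : R) (fun x : R => expR (- 2^-1 * x ^+ 2))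
    (expR (- 2^-1 * x ^+ 2) * - x).
  exact: (@is_derive1_comp R expR _ x _ _ (is_derive_expR _) dsq).
by apply: is_derive_eq; rewrite /GRing.scale/=; ring.
Qed.

Lemma normal_ibp (u u' : R -> R) :
  (forall x : R, is_derive x (1 : R) u (u' x)) -> continuous u' ->
  gamma.-integrable setT (EFin \o u) -> gamma.-integrable setT (EFin \o u') ->
  gamma.-integrable setT (EFin \o (fun x => x * u x)) ->
  (\int[gamma]_x (u' x - x * u x)%:E = 0)%E.
Proof.
move=> du cu' iu iu' ixu.
rewrite integral_normal; last exact: (integrableB measurableT iu' ixu).
apply: (@integral_derivative_eq0 (fun x => u x * phi x)).
- move=> x; have := du x; have := is_derive_normal_pdf x => dphi dux.
  apply: is_derive_eq; rewrite /GRing.scale/=; ring.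
- have cu : continuous u.
    by move=> x; apply: differentiable_continuous; apply/derivable1_diffP; case: (du x).
  move=> x; apply: cvgM; last exact: continuous_normal_pdf.
  by apply: cvgB; [exact: cu'|apply: cvgM; [exact: cvg_id|exact: cu]].
- exact: integrable_normal.
- apply: integrable_normal; exact: (integrableB measurableT iu' ixu).
Qed.

End normal.

(** * Integration by parts and exponential moments in R^n *)

Section gauss_integrals.
Context (R : realType).
Local Notation gamma := (@normal_prob R 0 1).

Lemma cons_rV0 n a (y : 'rV[R]_n) : cons_rV (a, y) 0 ord0 = a.
Proof. by rewrite mxE unlift_none. Qed.

Lemma cons_rV_lift n a (y : 'rV[R]_n) j : cons_rV (a, y) 0 (lift ord0 j) = y 0 j.
Proof. by rewrite mxE liftK. Qed.

Lemma cons_rV_head n a (y : 'rV[R]_n) :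
  cons_rV (a, y) = cons_rV (0, y) + a *: delta_mx 0 ord0.
Proof.
apply/rowP => k; rewrite !mxE; case: unliftP => [j ->|->] /=.
  by rewrite mulr0 addr0.
by rewrite mulr1 add0r.
Qed.

Lemma cons_rV_tail n a t (y : 'rV[R]_n) j :
  cons_rV (a, y + t *: delta_mx 0 j) =
  cons_rV (a, y) + t *: delta_mx 0 (lift ord0 j).
Proof.
apply/rowP => k; rewrite !mxE; case: unliftP => [l ->|->] /=.
  by rewrite !mxE (inj_eq (@lift_inj _ _)).
by rewrite mulr0 addr0.
Qed.

Lemma intg_gaussS n (f : 'rV[R]_n.+1 -> R) : intg (gauss R n.+1) f ->
  (gamma \x gauss R n)%E.-integrable setT (fun p => (f (cons_rV p))%:E).
Proof.
move=> /integrableP[mf fy]; apply/integrableP; split.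
  by apply: (measurableT_comp mf); exact: measurable_cons_rV.
move: fy; rewrite /= ge0_integral_pushforward//.
by apply/measurable_EFinP; apply: measurableT_comp => //; exact/measurable_EFinP.
Qed.

Lemma integral_gaussS n (f : 'rV[R]_n.+1 -> R) : intg (gauss R n.+1) f ->
  (\int[gauss R n.+1]_x (f x)%:E =
   \int[(gamma \x gauss R n)%E]_p (f (cons_rV p))%:E)%E.
Proof.
move=> jf; have mf := measurable_int _ jf.
by rewrite integral_pushforward//; exact: (intg_gaussS jf).
Qed.

(** Differentiability is asked along lines parallel to the [i]-th axis only, a
    condition inherited by the sections of [u] that Fubini's theorem produces. *)
Definition line_C1 n (i : 'I_n) (u u' : 'rV[R]_n -> R) := forall x,
  (forall t : R, is_derive t (1 : R) (fun s => u (x + s *: delta_mx 0 i))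
                             (u' (x + t *: delta_mx 0 i))) /\
  continuous (fun t : R => u' (x + t *: delta_mx 0 i)).

(** By Fubini, the one-dimensional formula applies to almost every section along
    the first coordinate, and the formula in dimension [n] to almost every
    section with the first coordinate fixed. *)
Lemma gauss_ibp n (i : 'I_n) (u u' : 'rV[R]_n -> R) : line_C1 i u u' ->
  intg (gauss R n) u -> intg (gauss R n) u' ->
  intg (gauss R n) (fun x => x 0 i * u x) ->
  (\int[gauss R n]_x (u' x - x 0 i * u x)%:E = 0)%E.
Proof.
elim: n i u u' => [[]//|n ih] i u u' du iu iu' ixu.
have iv := intgB iu' ixu.
rewrite integral_gaussS//.
have piu := intg_gaussS iu; have piu' := intg_gaussS iu'.
have pixu := intg_gaussS ixu; have piv := intg_gaussS iv.
case: (unliftP ord0 i) => [j|] Ei; subst i.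
- rewrite -integral12_prod_meas1//.
  rewrite (_ : 0%E = \int[gamma]_x (cst 0 x))%E; last by rewrite integral0.
  apply: ae_eq_integral => //; first exact: (measurable_fubini_F piv).
  move: (ae_integrable1 piu) (ae_integrable1 piu') (ae_integrable1 pixu).
  apply: filterS3 => a ju ju' jxu _ /=.
  transitivity (\int[gauss R n]_y
      (u' (cons_rV (a, y)) - y 0 j * u (cons_rV (a, y)))%:E)%E.
    by apply: eq_integral => y _; rewrite cons_rV_lift.
  apply: (ih j (fun y => u (cons_rV (a, y))) (fun y => u' (cons_rV (a, y)))) => //.
  + move=> x; have [d c] := du (cons_rV (a, x)); split => [t|].
      rewrite cons_rV_tail.
      by under eq_fun do rewrite cons_rV_tail; exact: d.
    by under eq_fun do rewrite cons_rV_tail; exact: c.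
  + by apply: eq_integrable jxu => // y _; rewrite /= cons_rV_lift.
- rewrite -integral21_prod_meas1//.
  rewrite (_ : 0%E = \int[gauss R n]_x (cst 0 x))%E; last by rewrite integral0.
  apply: ae_eq_integral => //; first exact: (measurable_fubini_G piv).
  move: (ae_integrable2 piu) (ae_integrable2 piu') (ae_integrable2 pixu).
  apply: filterS3 => y ju ju' jxu _ /=.
  transitivity (\int[gamma]_a
      (u' (cons_rV (a, y)) - a * u (cons_rV (a, y)))%:E)%E.
    by apply: eq_integral => a _; rewrite cons_rV0.
  have [d c] := du (cons_rV (0, y)).
  apply: (@normal_ibp R (fun a => u (cons_rV (a, y)))
                        (fun a => u' (cons_rV (a, y)))) => //.
  + move=> t; rewrite cons_rV_head.
    by under eq_fun do rewrite cons_rV_head; exact: d.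
  + by under eq_fun do rewrite cons_rV_head; exact: c.
  + by apply: eq_integrable jxu => // a _; rewrite /= cons_rV0.
Qed.

Definition sqnorm n (x : 'rV[R]_n) : R := \sum_i x 0 i ^+ 2.

Lemma sqnorm_ge0 n (x : 'rV[R]_n) : 0 <= sqnorm x.
Proof. by apply: sumr_ge0 => i _; exact: sqr_ge0. Qed.

Lemma measurable_sqnorm n : measurable_fun [set: 'rV[R]_n] (@sqnorm n).
Proof.
apply: measurable_sum => i; apply: measurable_funX.
exact: measurable_coord_rV.
Qed.

(** Up to a constant, [e^(x^2/4)] times the standard normal density is the normal
    density of variance [2]. *)
Lemma integral_normal_expR_sqr :
  (\int[gamma]_x (expR (4^-1 * x ^+ 2))%:E < +oo)%E.
Proof.
have m4 : measurable_fun [set: R] (fun x : R => expR (4^-1 * x ^+ 2)).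
  by apply: measurableT_comp => //; apply: measurable_funM => //;
    exact: measurable_funX.
rewrite ge0_integral_normal//; last exact/measurable_EFinP.
have s0 : Num.sqrt 2 != 0 :> R by rewrite gt_eqF// sqrtr_gt0.
rewrite (_ : (\int[_]_x _)%E = (\int[lebesgue_measure]_x
  ((normal_peak (1 : R) / normal_peak (Num.sqrt 2))%:E *
   (normal_pdf (0 : R) (Num.sqrt 2) x)%:E))%E).
  rewrite integralZl//; last exact: integrable_normal_pdf.
  by rewrite integral_normal_pdf mule1 ltry.
apply: eq_integral => x _; rewrite -!EFinM !normal_pdfE ?oner_neq0//=.
congr EFin; rewrite [RHS]mulrA divfK ?gt_eqF ?normal_peak_gt0//.
rewrite mulrCA /normal_fun -expRD; congr (_ * expR _).
by rewrite !subr0 sqr_sqrtr// expr1n; field.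
Qed.

Lemma intg_expR_sqnorm n :
  intg (gauss R n) (fun x => expR (4^-1 * sqnorm x)).
Proof.
have mf m : measurable_fun [set: 'rV[R]_m] (fun x => expR (4^-1 * sqnorm x)).
  apply: measurableT_comp => //.
  by apply: measurable_funM => //; exact: measurable_sqnorm.
elim: n => [|n ih].
  apply: eq_intg (intg_cst _ 1) => x.
  by rewrite /sqnorm big_ord0 mulr0 expR0.
apply/integrableP; split; first by apply/measurable_EFinP; exact: mf.
have mnf m : measurable_fun [set: 'rV[R]_m] (fun x => `|expR (4^-1 * sqnorm x)|%:E).
  by apply/measurable_EFinP; exact: (measurableT_comp _ (mf m)).
rewrite /= ge0_integral_pushforward//; last exact: mnf.
rewrite preimage_setT fubini_tonelli1//; last first.
- by move=> p; rewrite /= lee_fin.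
- exact: (measurableT_comp (mnf n.+1) (@measurable_cons_rV R n)).
move/integrableP : ih => [_].
set M := (X in (X < _)%E) => My.
have M0 : (0 <= M)%E by exact: integral_ge0.
rewrite (_ : (\int[_]_x _)%E = (\int[gamma]_x ((expR (4^-1 * x ^+ 2))%:E * M))%E).
  have m4 : measurable_fun [set: R] (fun x : R => (expR (4^-1 * x ^+ 2))%:E).
    apply/measurable_EFinP.
    by apply: measurableT_comp => //; apply: measurable_funM => //;
      exact: measurable_funX.
  rewrite ge0_integralZr//.
  by apply: lte_mul_pinfty => //; [exact: integral_ge0|
    rewrite ge0_fin_numE ?integral_normal_expR_sqr//; exact: integral_ge0].
apply: eq_integral => a _; rewrite /fubini_F -ge0_integralZl//; last exact: mnf.
apply: eq_integral => y _ /=; rewrite -EFinM; congr EFin.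
rewrite !ger0_norm ?expR_ge0// -expRD /sqnorm big_ord_recl cons_rV0 mulrDr.
by under eq_bigr do rewrite cons_rV_lift.
Qed.

End gauss_integrals.

(** * Polynomial functions and the creation operators *)

Section derivatives.
Context (R : realType) (n : nat).
Implicit Types (f g : 'rV[R]_n -> R) (i j : 'I_n) (x : 'rV[R]_n).
Local Notation e_ i := (delta_mx 0 i : 'rV[R]_n).

Lemma is_derive_partial i f x d : is_derive x (e_ i) f d -> partial i f x = d.
Proof. by move=> df; rewrite /partial derive_val. Qed.

Lemma is_derive_coord i j x :
  is_derive x (e_ i) (fun y : 'rV[R]_n => y 0 j) (i == j)%:R.
Proof.
have quot : (fun h : R => h^-1 *: (((fun y : 'rV[R]_n => y 0 j) \o shift x) (h *: e_ i)
    - (fun y : 'rV[R]_n => y 0 j) x)) @ 0^' --> ((i == j)%:R : R).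
  apply: (@cvg_trans _ ((fun=> (i == j)%:R : R) @ 0^')); last exact: cvg_cst.
  apply: near_eq_cvg; near=> h.
  have h0 : h != 0 by near: h; exact: nbhs_dnbhs_neq.
  by rewrite /= !mxE eqxx/= eq_sym addrK /GRing.scale/= mulrA mulVf ?mul1r.
by apply: DeriveDef; [apply/cvg_ex; eexists; exact: quot|exact: cvg_lim quot].
Unshelve. all: by end_near. Qed.

Lemma is_derive_line i f x (t : R) d : is_derive (x + t *: e_ i) (e_ i) f d ->
  is_derive t (1 : R) (fun s => f (x + s *: e_ i)) d.
Proof.
have quot : (fun h : R => h^-1 *: ((f \o shift (x + t *: e_ i)) (h *: e_ i)
      - f (x + t *: e_ i))) =
    (fun h : R => h^-1 *: (((fun s : R => f (x + s *: e_ i)) \o shift t) (h *: (1 : R))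
      - f (x + t *: e_ i))).
  apply/funext => h /=; congr (_ *: (f _ - _)).
  by rewrite [h *: 1]mulr1 scalerDl addrCA.
move=> [df vf]; apply: DeriveDef.
  by move: df; rewrite /derivable quot.
by rewrite -vf /derive quot.
Qed.

Lemma line_C1_derivable i f : (forall x, derivable f x (e_ i)) ->
  continuous (partial i f) -> line_C1 i f (partial i f).
Proof.
move=> df cf x; split => [t|t].
  by apply: is_derive_line; exact/derivableP/df.
apply: (@continuous_comp _ _ _ (fun s : R => x + s *: e_ i) (partial i f));
  last exact: cf.
by apply: cvgD; [exact: cvg_cst|exact: scalel_continuous].
Qed.

Lemma line_C1M i f f' g g' : line_C1 i f f' -> line_C1 i g g' ->
  line_C1 i (fun x => f x * g x) (fun x => f' x * g x + f x * g' x).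
Proof.
move=> lf lg x; have [df cf'] := lf x; have [dg cg'] := lg x.
have cf : continuous (fun t : R => f (x + t *: e_ i)).
  by move=> t; apply: differentiable_continuous; apply/derivable1_diffP; case: (df t).
have cg : continuous (fun t : R => g (x + t *: e_ i)).
  by move=> t; apply: differentiable_continuous; apply/derivable1_diffP; case: (dg t).
split => t.
  have dft := df t; have dgt := dg t; apply: is_derive_eq.
  by rewrite /GRing.scale/= addrC [g _ * _]mulrC.
by apply: cvgD; apply: cvgM; [exact: cf'|exact: cg|exact: cf|exact: cg'].
Qed.

End derivatives.

Section polynomials.
Context (R : realType) (n : nat).
Implicit Types (p q F : 'rV[R]_n -> R) (i j : 'I_n) (x : 'rV[R]_n).
Local Notation e_ i := (delta_mx 0 i : 'rV[R]_n).

(** Multiplication by coordinates instead of products keeps the induction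
    principle close to the recursions satisfied by Hermite polynomials. *)
Inductive polyfun : ('rV[R]_n -> R) -> Prop :=
| polyfun_cst c : polyfun (fun=> c)
| polyfunD p q of polyfun p & polyfun q : polyfun (fun x => p x + q x)
| polyfunXM i p of polyfun p : polyfun (fun x => x 0 i * p x).

Lemma eq_polyfun p q : p =1 q -> polyfun p -> polyfun q.
Proof. by move=> /funext ->. Qed.

Lemma polyfunM p q : polyfun p -> polyfun q -> polyfun (fun x => p x * q x).
Proof.
move=> hp hq; elim: hp => [c|p1 p2 _ h1 _ h2|i p1 _ h1].
- elim: hq => [c'|q1 q2 _ h1 _ h2|i q1 _ h1]; first exact: (polyfun_cst (c * c')).
    by apply: eq_polyfun (polyfunD h1 h2) => x; ring.
  by apply: eq_polyfun (polyfunXM i h1) => x; ring.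
- by apply: eq_polyfun (polyfunD h1 h2) => x; ring.
- by apply: eq_polyfun (polyfunXM i h1) => x; ring.
Qed.

Lemma polyfunZ c p : polyfun p -> polyfun (fun x => c * p x).
Proof. exact: polyfunM (polyfun_cst c). Qed.

Lemma polyfunB p q : polyfun p -> polyfun q -> polyfun (fun x => p x - q x).
Proof.
by move=> hp hq; apply: eq_polyfun (polyfunD hp (polyfunZ (-1) hq)) => x; ring.
Qed.

Lemma polyfunX p k : polyfun p -> polyfun (fun x => p x ^+ k).
Proof.
move=> hp; elim: k => [|k ih]; first exact: (polyfun_cst 1).
by apply: eq_polyfun (polyfunM hp ih) => x; rewrite exprS.
Qed.

Lemma polyfun_coord i : polyfun (fun x => x 0 i).
Proof. by apply: eq_polyfun (polyfunXM i (polyfun_cst 1)) => x; rewrite mulr1. Qed.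

Lemma polyfun_sum I (s : seq I) (F : I -> 'rV[R]_n -> R) :
  (forall k, polyfun (F k)) -> polyfun (fun x => \sum_(k <- s) F k x).
Proof.
move=> hF; elim: s => [|a s ih].
  by apply: eq_polyfun (polyfun_cst 0) => x; rewrite big_nil.
by apply: eq_polyfun (polyfunD (hF a) ih) => x; rewrite big_cons.
Qed.

(** The inductive step absorbs the factor [|x_i| <= 1 + x_i^2] into
    [e^(d |x|^2 / 2)]. *)
Lemma polyfun_growth p : polyfun p -> forall d, 0 < d ->
  exists C, 0 <= C /\ forall x, `|p x| <= C * expR (d * sqnorm x).
Proof.
elim => [c|p1 p2 _ h1 _ h2|i p1 _ h1] d d0.
- exists `|c|; split => // x; rewrite ler_peMr// -expR0 ler_expR.
  by apply: mulr_ge0; [exact: ltW|exact: sqnorm_ge0].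
- have [C1 [C10 b1]] := h1 d d0; have [C2 [C20 b2]] := h2 d d0.
  exists (C1 + C2); split; first exact: addr_ge0.
  by move=> x; rewrite mulrDl (le_trans (ler_normD _ _))// lerD.
- have d20 : 0 < d / 2 by rewrite divr_gt0.
  have [C [C0 b]] := h1 (d / 2) d20.
  exists ((1 + 2 / d) * C); split.
    by rewrite mulr_ge0// addr_ge0// divr_ge0// ltW.
  move=> x; rewrite normrM.
  have -> : expR (d * sqnorm x) = expR (d / 2 * sqnorm x) * expR (d / 2 * sqnorm x).
    by rewrite -expRD; congr expR; field.
  rewrite mulrACA ler_pM//.
  apply: (@le_trans _ _ (1 + x 0 i ^+ 2)).
    rewrite -(real_normK (num_real (x 0 i))).
    have := sqr_ge0 (`|x 0 i| - 1); have := normr_ge0 (x 0 i).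
    by move: `|_| => a; nra.
  have xi : x 0 i ^+ 2 <= sqnorm x.
    by rewrite /sqnorm (bigD1 i)//= lerDl sumr_ge0// => k _; exact: sqr_ge0.
  have := expR_ge1Dx (d / 2 * sqnorm x); set y := expR _ => ey.
  have s0 := sqnorm_ge0 x.
  have y1 : 1 <= y by apply: le_trans ey; rewrite lerDl mulr_ge0// ltW.
  rewrite mulrDl mul1r lerD// (le_trans xi)//.
  have : 2 / d * (1 + d / 2 * sqnorm x) <= 2 / d * y.
    by rewrite ler_wpM2l// divr_ge0// ltW.
  apply: le_trans; rewrite mulrDr mulrA.
  have -> : 2 / d * (d / 2) = 1 by field; rewrite gt_eqF.
  by rewrite mul1r lerDr mulr1 divr_ge0// ltW.
Qed.

Lemma measurable_polyfun p : polyfun p -> measurable_fun [set: 'rV[R]_n] p.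
Proof.
elim => [c|p1 p2 _ h1 _ h2|i p1 _ h1].
- exact: measurable_cst.
- exact: measurable_funD.
- by apply: measurable_funM => //; exact: measurable_coord_rV.
Qed.

Lemma sqintg_expR_sqnorm :
  sqintg (gauss R n) (fun x : 'rV[R]_n => expR (8^-1 * sqnorm x)).
Proof.
split.
  apply: measurableT_comp => //; apply: measurable_funM => //.
  exact: measurable_sqnorm.
apply: eq_intg (intg_expR_sqnorm R n) => x.
by rewrite -expRM_natl; congr expR; field.
Qed.

Lemma sqintg_polyfun p : polyfun p -> sqintg (gauss R n) p.
Proof.
move=> hp; have [|C [C0 b]] := polyfun_growth hp (d := 8^-1).
  by rewrite invr_gt0.
apply: sqintg_le (sqintgZ C sqintg_expR_sqnorm) b.
exact: measurable_polyfun.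
Qed.

Lemma is_derive_polyfunXM i j p x : derivable p x (e_ i) ->
  is_derive x (e_ i) (fun y : 'rV[R]_n => y 0 j * p y)
    ((i == j)%:R * p x + x 0 j * partial i p x).
Proof.
move=> /derivableP dp; have dj := is_derive_coord i j x.
apply: is_derive_eq.
by rewrite /GRing.scale/= addrC mulrC.
Qed.

Lemma derivable_polyfun p : polyfun p -> forall i x, derivable p x (e_ i).
Proof.
elim => [c|p1 p2 _ h1 _ h2|j p1 _ h1] i x.
- exact: derivable_cst.
- exact: derivableD.
- by have [] := is_derive_polyfunXM j (h1 i x).
Qed.

Lemma partial_cst i (c : R) : partial i (fun=> c) = fun=> 0.
Proof.
by apply/funext => x; apply: is_derive_partial; exact: is_derive_cst.
Qed.

Lemma partialD i p q : polyfun p -> polyfun q ->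
  partial i (fun x => p x + q x) = fun x => partial i p x + partial i q x.
Proof.
move=> hp hq; apply/funext => x; apply: deriveD; exact: derivable_polyfun.
Qed.

Lemma partialM i p q : polyfun p -> polyfun q ->
  partial i (fun x => p x * q x) =
  fun x => partial i p x * q x + p x * partial i q x.
Proof.
move=> hp hq; apply/funext => x; rewrite /partial.
have := @deriveM _ _ p q x (e_ i) (@derivable_polyfun p hp i x)
                                  (@derivable_polyfun q hq i x).
by move=> ->; rewrite /GRing.scale/= addrC [q x * _]mulrC.
Qed.

Lemma partialZ i c p : polyfun p ->
  partial i (fun x => c * p x) = fun x => c * partial i p x.
Proof.
move=> hp; rewrite partialM//; last exact: polyfun_cst.
by apply/funext => x; rewrite partial_cst mul0r add0r.
Qed.

Lemma partialB i p q : polyfun p -> polyfun q ->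
  partial i (fun x => p x - q x) = fun x => partial i p x - partial i q x.
Proof.
move=> hp hq; apply/funext => x; apply: deriveB; exact: derivable_polyfun.
Qed.

Lemma partialXM i j p : polyfun p ->
  partial i (fun x => x 0 j * p x) =
  fun x => (i == j)%:R * p x + x 0 j * partial i p x.
Proof.
move=> hp; apply/funext => x; apply: is_derive_partial.
by apply: is_derive_polyfunXM; exact: derivable_polyfun.
Qed.

Lemma polyfun_partial p i : polyfun p -> polyfun (partial i p).
Proof.
elim => [c|p1 p2 q1 h1 q2 h2|j p1 q1 h1].
- by rewrite partial_cst; exact: polyfun_cst.
- by rewrite partialD//; exact: polyfunD.
- by rewrite partialXM//; apply: polyfunD; [exact: polyfunZ|exact: polyfunXM].
Qed.

Lemma partial_sum i I (s : seq I) (F : I -> 'rV[R]_n -> R) :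
  (forall k, polyfun (F k)) -> partial i (fun x => \sum_(k <- s) F k x) =
  fun x => \sum_(k <- s) partial i (F k) x.
Proof.
move=> hF; elim: s => [|a s ih].
  rewrite (_ : (fun x => \sum_(k <- [::]) F k x) = fun=> 0); last first.
    by apply/funext => x; rewrite big_nil.
  by rewrite partial_cst; apply/funext => x; rewrite big_nil.
rewrite (_ : (fun x => \sum_(k <- a :: s) F k x) =
    fun x => F a x + \sum_(k <- s) F k x); last first.
  by apply/funext => x; rewrite big_cons.
rewrite partialD//; last exact: polyfun_sum.
by apply/funext => x; rewrite big_cons ih.
Qed.

Lemma partialC i j p : polyfun p -> partial i (partial j p) = partial j (partial i p).
Proof.
elim => [c|p1 p2 q1 h1 q2 h2|k p1 q1 h1].
- by rewrite !partial_cst.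
- rewrite (partialD j q1 q2) (partialD i q1 q2).
  rewrite (partialD i (polyfun_partial j q1) (polyfun_partial j q2)).
  by rewrite (partialD j (polyfun_partial i q1) (polyfun_partial i q2)) h1 h2.
- rewrite (partialXM j k q1) (partialXM i k q1).
  have pp m := polyfun_partial m q1.
  rewrite (partialD i (polyfunZ _ q1) (polyfunXM k (pp j))).
  rewrite (partialD j (polyfunZ _ q1) (polyfunXM k (pp i))).
  rewrite (partialZ i _ q1) (partialZ j _ q1).
  rewrite (partialXM i k (pp j)) (partialXM j k (pp i)) h1.
  by apply/funext => x; ring.
Qed.

Lemma continuous_polyfun p : polyfun p -> continuous p.
Proof.
elim => [c|p1 p2 _ h1 _ h2|j p1 _ h1] x.
- exact: cst_continuous.
- exact: (continuousD (h1 x) (h2 x)).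
- exact: (continuousM (@coord_continuous _ _ _ 0 j x) (h1 x)).
Qed.

Lemma line_C1_polyfun i p : polyfun p -> line_C1 i p (partial i p).
Proof.
move=> hp; apply: line_C1_derivable; first exact: derivable_polyfun.
exact/continuous_polyfun/polyfun_partial.
Qed.

(** The creation operator, adjoint to [partial i] in [L^2] of the Gaussian
    measure. *)
Definition raise i F x := x 0 i * F x - partial i F x.

Lemma polyfun_raise i F : polyfun F -> polyfun (raise i F).
Proof. by move=> hF; apply: polyfunB; [exact: polyfunXM|exact: polyfun_partial]. Qed.

Local Notation E f := (\int[gauss R n]_x f x).

Lemma E_partial_raise i f f' F : line_C1 i f f' ->
  sqintg (gauss R n) f -> sqintg (gauss R n) f' -> polyfun F ->
  E (fun x => f' x * F x) = E (fun x => f x * raise i F x).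
Proof.
move=> lf jf jf' hF.
have jF := sqintg_polyfun hF.
have jdF := sqintg_polyfun (polyfun_partial i hF).
have jxF := sqintg_polyfun (polyfunXM i hF).
have jrF := sqintg_polyfun (polyfun_raise i hF).
have i1 := intg_mul jf' jF; have i2 := intg_mul jf jdF.
have i3 := intg_mul jf jxF.
have ixu : intg (gauss R n) (fun x => x 0 i * (f x * F x)).
  by apply: eq_intg i3 => x; ring.
have := gauss_ibp (line_C1M lf (line_C1_polyfun i hF)) (intg_mul jf jF)
                  (intgD i1 i2) ixu.
move=> /(congr1 fine) /= E0; apply/eqP; rewrite -subr_eq0 -EB//.
  by rewrite -[X in _ == X]E0; apply/eqP; apply: eq_E => x; rewrite /raise; ring.
exact: intg_mul.
Qed.

End polynomials.

(** * Wiener chaos *)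

Section chaos.
Context (R : realType) (n : nat).
Implicit Types (p q f g F G : 'rV[R]_n -> R) (i j : 'I_n) (x : 'rV[R]_n).
Local Notation E f := (\int[gauss R n]_x f x).
Local Notation sqi := (sqintg (gauss R n)).

Lemma raiseD i F G : polyfun F -> polyfun G ->
  raise i (fun x => F x + G x) = fun x => raise i F x + raise i G x.
Proof.
by move=> hF hG; apply/funext => x; rewrite /raise partialD//; ring.
Qed.

Lemma raiseZ i c F : polyfun F ->
  raise i (fun x => c * F x) = fun x => c * raise i F x.
Proof. by move=> hF; apply/funext => x; rewrite /raise partialZ//; ring. Qed.

Lemma raise_sum i I (s : seq I) (F : I -> 'rV[R]_n -> R) :
  (forall k, polyfun (F k)) -> raise i (fun x => \sum_(k <- s) F k x) =
  fun x => \sum_(k <- s) raise i (F k) x.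
Proof.
move=> hF; apply/funext => x; rewrite /raise partial_sum//.
by rewrite mulr_sumr -sumrB.
Qed.

Lemma raiseC i j F : polyfun F -> raise i (raise j F) = raise j (raise i F).
Proof.
move=> hF; apply/funext => x; rewrite /raise.
rewrite (partialB i (polyfunXM j hF) (polyfun_partial j hF)).
rewrite (partialB j (polyfunXM i hF) (polyfun_partial i hF)).
rewrite (partialXM i j hF) (partialXM j i hF) (partialC i j hF) [j == i]eq_sym.
ring.
Qed.

Lemma partial_raise j i F : polyfun F ->
  partial j (raise i F) = fun x => (j == i)%:R * F x + raise i (partial j F) x.
Proof.
move=> hF; apply/funext => x; rewrite /raise.
rewrite (partialB j (polyfunXM i hF) (polyfun_partial i hF)).
by rewrite (partialXM j i hF) (partialC j i hF); ring.
Qed.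

(** The number operator, that is, minus the Ornstein-Uhlenbeck generator. *)
Definition numop F x := \sum_i raise i (partial i F) x.

(** Eigenfunctions of the number operator for the eigenvalue [k]. The recursive
    clause on the derivatives is built in so that induction on [k] runs without
    any basis of the eigenspace. *)
Fixpoint chaos (k : nat) F : Prop :=
  [/\ polyfun F, numop F = (fun x => k%:R * F x) &
  if k is k'.+1 then forall i, chaos k' (partial i F) else exists c, F = fun=> c].

Lemma chaos_polyfun k F : chaos k F -> polyfun F.
Proof. by case: k => [|k] -[]. Qed.

Lemma chaos_numop k F : chaos k F -> numop F = fun x => k%:R * F x.
Proof. by case: k => [|k] -[]. Qed.

Lemma chaos_partial k F i : chaos k.+1 F -> chaos k (partial i F).
Proof. by case=> _ _; apply. Qed.

Lemma chaos_cst c : chaos 0 (fun=> c).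
Proof.
split; [exact: polyfun_cst| |by exists c].
apply/funext => x; rewrite mul0r /numop big1// => i _.
by rewrite /raise partial_cst partial_cst mulr0 subr0.
Qed.

Lemma chaosD k F G : chaos k F -> chaos k G -> chaos k (fun x => F x + G x).
Proof.
elim: k F G => [|k ih] F G cF cG; have [pF nF dF] := cF; have [pG nG dG] := cG.
  by have [c ->] := dF; have [c' ->] := dG; exact: (chaos_cst (c + c')).
split; first exact: polyfunD.
  apply/funext => x; rewrite mulrDr -[k.+1%:R * F x](congr1 (@^~ x) nF).
  rewrite -[k.+1%:R * G x](congr1 (@^~ x) nG) /numop -big_split/=.
  apply: eq_bigr => i _; rewrite (partialD i pF pG).
  exact: (congr1 (@^~ x) (raiseD i (polyfun_partial i pF) (polyfun_partial i pG))).
by move=> i; rewrite (partialD i pF pG); exact: ih (dF i) (dG i).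
Qed.

Lemma chaosZ k c F : chaos k F -> chaos k (fun x => c * F x).
Proof.
elim: k F => [|k ih] F cF; have [pF nF dF] := cF.
  by have [c' ->] := dF; exact: (chaos_cst (c * c')).
split; first exact: polyfunZ.
  apply/funext => x; rewrite mulrCA -[k.+1%:R * F x](congr1 (@^~ x) nF).
  rewrite /numop mulr_sumr; apply: eq_bigr => i _.
  by rewrite (partialZ i c pF) (raiseZ i c (polyfun_partial i pF)).
by move=> i; rewrite (partialZ i c pF); exact: ih (dF i).
Qed.

Lemma chaos0 k : chaos k (fun=> 0).
Proof.
elim: k => [|k ih]; first exact: chaos_cst.
split; first exact: polyfun_cst; last by move=> i; rewrite partial_cst.
apply/funext => x; rewrite mulr0 /numop big1// => i _.
by rewrite /raise partial_cst partial_cst mulr0 subr0.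
Qed.

Lemma chaos_sum k I (s : seq I) (F : I -> 'rV[R]_n -> R) :
  (forall m, chaos k (F m)) -> chaos k (fun x => \sum_(m <- s) F m x).
Proof.
move=> hF; elim: s => [|a s ih].
  rewrite (_ : (fun x => \sum_(m <- [::]) F m x) = fun=> 0); first exact: chaos0.
  by apply/funext => x; rewrite big_nil.
rewrite (_ : (fun x => _) = fun x => F a x + \sum_(m <- s) F m x).
  exact: chaosD.
by apply/funext => x; rewrite big_cons.
Qed.

(** [partial i] and [raise i] satisfy the canonical commutation relations, so
    [raise i] shifts the eigenvalues of the number operator by one. *)
Lemma numop_raise i F : polyfun F ->
  numop (raise i F) = fun x => raise i F x + raise i (numop F) x.
Proof.
move=> pF; have pd j := polyfun_partial j pF.
apply/funext => x; rewrite /numop raise_sum; last first.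
  by move=> j; exact: polyfun_raise.
transitivity (\sum_j ((j == i)%:R * raise j F x + raise i (raise j (partial j F)) x)).
  apply: eq_bigr => j _; rewrite (partial_raise j i pF).
  rewrite (raiseD j (polyfunZ _ pF) (polyfun_raise i (pd j))).
  by rewrite (raiseZ j _ pF) (raiseC j i (pd j)).
rewrite big_split/=; congr (_ + _); rewrite (bigD1 i)//= eqxx mul1r big1 ?addr0// => j.
by move=> /negbTE ->; rewrite mul0r.
Qed.

Lemma chaos_raise k i F : chaos k F -> chaos k.+1 (raise i F).
Proof.
elim: k i F => [|k ih] i F cF; have [pF nF dF] := cF.
- split; first exact: polyfun_raise.
    rewrite (numop_raise i pF) nF; apply/funext => x.
    by rewrite (raiseZ i _ pF); ring.
  move=> j; rewrite (partial_raise j i pF); have [c ->] := dF.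
  rewrite partial_cst (_ : (fun x => _) = fun=> (j == i)%:R * c).
    exact: chaos_cst.
  by apply/funext => x; rewrite /raise partial_cst mulr0 subr0 addr0.
- split; first exact: polyfun_raise.
    rewrite (numop_raise i pF) nF; apply/funext => x.
    by rewrite (raiseZ i _ pF) -[k.+2]addn1 natrD; ring.
  move=> j; rewrite (partial_raise j i pF); apply: chaosD; first exact: chaosZ.
  exact/ih/dF.
Qed.

Lemma E_numop F G : polyfun F -> polyfun G ->
  E (fun x => F x * numop G x) = \sum_i E (fun x => partial i F x * partial i G x).
Proof.
move=> pF pG.
have jF := sqintg_polyfun pF.
have jr i := sqintg_polyfun (polyfun_raise i (polyfun_partial i pG)).
rewrite (@eq_E _ _ _ _ _ (fun x => \sum_i F x * raise i (partial i G) x)); last first.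
  by move=> x; rewrite mulr_sumr.
rewrite E_sum; last by move=> i; exact: intg_mul.
apply: eq_bigr => i _; rewrite (E_partial_raise (line_C1_polyfun i pF))//.
- exact/sqintg_polyfun/polyfun_partial.
- exact: polyfun_partial.
Qed.

(** Eigenfunctions of a symmetric operator for distinct eigenvalues. *)
Lemma chaos_orthogonal (j k : nat) F G : j != k -> chaos j F -> chaos k G ->
  E (fun x => F x * G x) = 0.
Proof.
move=> jk cF cG; have pF := chaos_polyfun cF; have pG := chaos_polyfun cG.
have iFG := intg_mul (sqintg_polyfun pF) (sqintg_polyfun pG).
have eG : k%:R * E (fun x => F x * G x) = E (fun x => F x * numop G x).
  by rewrite -EZ//; apply: eq_E => x; rewrite (chaos_numop cG); ring.
have eF : j%:R * E (fun x => F x * G x) = E (fun x => G x * numop F x).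
  rewrite -(EZ _ iFG).
  apply: eq_E => x.
  rewrite (chaos_numop cF).
  by ring.
have := eF; rewrite (E_numop pG pF).
have -> : \sum_i E (fun x => partial i G x * partial i F x) =
          \sum_i E (fun x => partial i F x * partial i G x).
  by apply: eq_bigr => i _; apply: eq_E => x; rewrite mulrC.
rewrite -(E_numop pF pG) -eG => /eqP.
rewrite -subr_eq0 -mulrBl mulf_eq0 => /orP[|/eqP//].
by rewrite subr_eq0 eqr_nat (negbTE jk).
Qed.

Lemma chaos_energy_partial k F : chaos k F ->
  \sum_i E (fun x => partial i F x ^+ 2) = k%:R * E (fun x => F x ^+ 2).
Proof.
move=> cF; have pF := chaos_polyfun cF.
have [_ iF2] := sqintg_polyfun pF.
transitivity (E (fun x => F x * numop F x)); last first.
  by rewrite -EZ//; apply: eq_E => x; rewrite (chaos_numop cF); ring.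
by rewrite (E_numop pF pF); apply: eq_bigr => i _; apply: eq_E => x; rewrite expr2.
Qed.

(** Hypercontractivity on a chaos, from [L^2] to [L^4]. With [N] the number
    operator, [k E(F^4) = E(F^3 N F) = 3 sum_i E((d_i F)^2 F^2)]. By
    Cauchy-Schwarz and the induction hypothesis for [d_i F], which lies in the
    chaos of order [k - 1], the sum is at most
    [3^(k-1) sum_i E((d_i F)^2) E(F^4)^(1/2) = 3^(k-1) k E(F^2) E(F^4)^(1/2)],
    and one divides by [k E(F^4)^(1/2)]. *)
Lemma chaos_hypercontractive k F : chaos k F ->
  E (fun x => F x ^+ 4) <= (3 ^+ k * E (fun x => F x ^+ 2)) ^+ 2.
Proof.
elim: k F => [|k ih] F cF.
  have [_ _ [c ->]] := cF.
  rewrite (_ : E (fun=> c ^+ 4) = c ^+ 4); last exact: E_cst.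
  by rewrite (_ : E (fun=> c ^+ 2) = c ^+ 2) ?mul1r -?exprM//; exact: E_cst.
have pF := chaos_polyfun cF.
have pd i := polyfun_partial i pF.
have sq p m : polyfun p -> sqi (fun x => p x ^+ m).
  by move=> pp; exact/sqintg_polyfun/polyfunX.
set A := E (fun x => F x ^+ 4).
have A0 : 0 <= A by apply: E_ge0 => x; rewrite (exprM _ 2 2) sqr_ge0.
set B := E (fun x => F x ^+ 2).
have B0 : 0 <= B by apply: E_ge0 => x; rewrite sqr_ge0.
pose s := Num.sqrt A.
have s0 : 0 <= s by exact: sqrtr_ge0.
have ss : s ^+ 2 = A by rewrite sqr_sqrtr.
have step i : E (fun x => partial i F x ^+ 2 * F x ^+ 2) <=
    3 ^+ k * E (fun x => partial i F x ^+ 2) * s.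
  rewrite -(@ler_pXn2r _ 2)// ?nnegrE; last 2 first.
  - by apply: E_ge0 => x; rewrite mulr_ge0 ?sqr_ge0.
  - by rewrite !mulr_ge0 ?exprn_ge0//; apply: E_ge0 => x; rewrite sqr_ge0.
  apply: le_trans (E_cauchy_schwarz (sq _ 2%N (pd i)) (sq _ 2%N pF)) _.
  rewrite exprMn ss; apply: ler_pM.
  - by apply: E_ge0 => x; rewrite sqr_ge0.
  - by apply: E_ge0 => x; rewrite sqr_ge0.
  - apply: le_trans (ih _ (chaos_partial i cF)).
    by rewrite le_eqVlt; apply/orP; left; apply/eqP/eq_E => x; rewrite -exprM.
  - by rewrite le_eqVlt; apply/orP; left; apply/eqP/eq_E => x; rewrite -exprM.
have moment : k.+1%:R * A = 3 * \sum_i E (fun x => partial i F x ^+ 2 * F x ^+ 2).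
  have [_ iF2] := sq _ 2%N pF.
  transitivity (E (fun x => F x ^+ 3 * numop F x)).
    rewrite -EZ; last by apply: eq_intg iF2 => x; rewrite -exprM.
    by apply: eq_E => x; rewrite (chaos_numop cF); ring.
  rewrite (E_numop (polyfunX 3 pF) pF).
  rewrite mulr_sumr; apply: eq_bigr => i _.
  rewrite -EZ; last by apply: intg_mul; exact: sq.
  apply: eq_E => x.
  have -> : partial i (fun x => F x ^+ 3) x = 3 * F x ^+ 2 * partial i F x.
    rewrite (_ : (fun x => F x ^+ 3) = fun x => F x * (F x * F x)); last first.
      by apply/funext => y; rewrite !exprS expr0 mulr1.
    by rewrite (partialM i pF (polyfunM pF pF)) (partialM i pF pF); ring.
  by ring.
have key : A <= 3 ^+ k.+1 * B * s.
  have k0 : 0 < k.+1%:R :> R by rewrite ltr0n.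
  rewrite -(ler_pM2l k0) moment.
  apply: (@le_trans _ _ (3 * \sum_i 3 ^+ k * E (fun x => partial i F x ^+ 2) * s)).
    by rewrite ler_wpM2l// ler_sum.
  rewrite -mulr_suml -mulr_sumr (chaos_energy_partial cF) -/B exprS.
  by rewrite le_eqVlt; apply/orP; left; apply/eqP; ring.
rewrite -ss lerXn2r ?nnegrE//; first by rewrite mulr_ge0// exprn_ge0.
have [s_eq0|s_neq0] := eqVneq s 0; first by rewrite s_eq0 mulr_ge0// exprn_ge0.
have s_gt0 : 0 < s by rewrite lt_neqAle eq_sym s_neq0.
by rewrite -(ler_pM2r s_gt0) -expr2 ss.
Qed.

(** Hermite polynomials are indexed by words in the coordinates, not by
    multi-indices: a partial derivative of [f] then merely prepends a letter to
    the index of its coefficients, at the cost of each polynomial of degree [k]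
    being listed with a multiplicity, which the factor [1 / k!] in [proj] and
    [energy] compensates. *)
Fixpoint words (k : nat) : seq (seq 'I_n) :=
  if k is k'.+1 then [seq i :: w | i <- index_enum 'I_n, w <- words k'] else [:: [::]].

Lemma big_wordsS k (G : seq 'I_n -> R) :
  \sum_(w <- words k.+1) G w = \sum_i \sum_(w <- words k) G (i :: w).
Proof. by rewrite /= big_allpairs_dep. Qed.

Fixpoint hermite (w : seq 'I_n) : 'rV[R]_n -> R :=
  if w is i :: w' then raise i (hermite w') else fun=> 1.

Lemma chaos_hermite w : chaos (size w) (hermite w).
Proof. by elim: w => [|i w ih]; [exact: chaos_cst|exact: chaos_raise]. Qed.

Lemma polyfun_hermite w : polyfun (hermite w).
Proof. exact: chaos_polyfun (chaos_hermite w). Qed.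

Lemma sqi_hermite w : sqi (hermite w).
Proof. exact/sqintg_polyfun/polyfun_hermite. Qed.

Lemma size_words k w : w \in words k -> size w = k.
Proof.
elim: k w => [|k ih] w /=; first by rewrite inE => /eqP ->.
by move=> /allpairsP[[i v] [_ /ih <- ->]].
Qed.

Definition coef f w := E (fun x => f x * hermite w x).

Definition proj k f x := k`!%:R^-1 * \sum_(w <- words k) coef f w * hermite w x.

(** The squared [L^2] norm of [proj k f], by [E_proj_sqr]. *)
Definition energy k f := k`!%:R^-1 * \sum_(w <- words k) coef f w ^+ 2.

Lemma energy_ge0 k f : 0 <= energy k f.
Proof. by rewrite mulr_ge0 ?invr_ge0// sumr_ge0// => w _; exact: sqr_ge0. Qed.

Lemma chaos_proj k f : chaos k (proj k f).
Proof.
apply: chaosZ.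
rewrite (_ : (fun x => \sum_(w <- words k) coef f w * hermite w x) =
  fun x => \sum_(w <- words k) (if size w == k then coef f w * hermite w x else 0)).
  apply: chaos_sum => w; case: eqP => [<-|_]; last exact: chaos0.
  exact/chaosZ/chaos_hermite.
by apply/funext => x; apply: eq_big_seq => w /size_words ->; rewrite eqxx.
Qed.

Lemma sqi_proj k f : sqi (proj k f).
Proof. exact/sqintg_polyfun/(chaos_polyfun (chaos_proj k f)). Qed.

Lemma coef_partial i f f' w : line_C1 i f f' -> sqi f -> sqi f' ->
  coef f' w = coef f (i :: w).
Proof.
by move=> lf jf jf'; apply: E_partial_raise => //; exact: polyfun_hermite.
Qed.

(** A word of length [k + 1] is a letter followed by a word of length [k], and
    removing the letter differentiates. *)
Lemma energy_partial k f (f_ : 'I_n -> 'rV[R]_n -> R) :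
  (forall i, line_C1 i f (f_ i)) -> sqi f -> (forall i, sqi (f_ i)) ->
  \sum_i energy k (f_ i) = k.+1%:R * energy k.+1 f.
Proof.
move=> lf jf jf_; rewrite /energy -mulr_sumr big_wordsS mulrA; congr (_ * _).
  by rewrite factS natrM invfM mulrA divff ?mul1r// pnatr_eq0.
apply: eq_bigr => i _; apply: eq_bigr => w _.
by rewrite (coef_partial w (lf i)).
Qed.

(** By induction, [(k + 1) * proj (k + 1) F = sum_i raise i (proj k (d_i F))]
    is [sum_i raise i (d_i F)], which is [(k + 1) * F]. *)
Lemma proj_id k F : chaos k F -> proj k F = F.
Proof.
elim: k F => [|k ih] F cF; apply/funext => x.
  have [_ _ [c ->]] := cF.
  rewrite /proj big_seq1/= /coef fact0 invr1 mul1r mulr1 /=.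
  by rewrite mulr1; exact: E_cst.
have pF := chaos_polyfun cF; have jF := sqintg_polyfun pF.
have pd i := polyfun_partial i pF.
have k0 : k.+1%:R != 0 :> R by rewrite pnatr_eq0.
apply: (mulfI k0); rewrite -[RHS](congr1 (@^~ x) (chaos_numop cF)) /numop.
rewrite /proj mulrA factS natrM invfM mulrA divff// mul1r big_wordsS mulr_sumr.
apply: eq_bigr => i _; rewrite -(ih _ (chaos_partial i cF)) /proj.
have ph w : polyfun (fun y => coef (partial i F) w * hermite w y).
  exact/polyfunZ/polyfun_hermite.
rewrite (raiseZ i _ (polyfun_sum (words k) ph)) (raise_sum i (words k) ph).
congr (_ * _); apply: eq_bigr => w _.
rewrite (raiseZ i _ (polyfun_hermite w)).
by rewrite (coef_partial w (line_C1_polyfun i pF))//; exact: sqintg_polyfun.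
Qed.

Lemma E_proj k f g : sqi f -> sqi g ->
  E (fun x => proj k f x * g x) = k`!%:R^-1 * \sum_(w <- words k) coef f w * coef g w.
Proof.
move=> jf jg.
have jh w : intg (gauss R n) (fun x => coef f w * (g x * hermite w x)).
  exact/intgZ/intg_mul/sqi_hermite.
rewrite (@eq_E _ _ _ _ _ (fun x =>
  k`!%:R^-1 * \sum_(w <- words k) coef f w * (g x * hermite w x))); last first.
  move=> x; rewrite /proj -mulrA mulr_suml; congr (_ * _).
  by apply: eq_bigr => w _; ring.
rewrite EZ; last exact: intg_sum.
rewrite E_sum//; congr (_ * _); apply: eq_bigr => w _.
by rewrite EZ//; apply: intg_mul => //; exact: sqi_hermite.
Qed.

Lemma E_proj_self k f : sqi f -> E (fun x => proj k f x * f x) = energy k f.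
Proof. by move=> jf; rewrite E_proj. Qed.

Lemma E_projC k f g : sqi f -> sqi g ->
  E (fun x => proj k f x * g x) = E (fun x => f x * proj k g x).
Proof.
move=> jf jg; rewrite E_proj//.
rewrite (@eq_E _ _ _ _ (fun x => f x * proj k g x)
                        (fun x => proj k g x * f x)); last first.
  by move=> x; rewrite mulrC.
by rewrite E_proj//; congr (_ * _); apply: eq_bigr => w _; rewrite mulrC.
Qed.

Lemma E_proj_sqr k f : sqi f -> E (fun x => proj k f x ^+ 2) = energy k f.
Proof.
move=> jf; rewrite -E_proj_self//.
rewrite (@eq_E _ _ _ _ (fun x => proj k f x ^+ 2)
                        (fun x => proj k f x * proj k f x))//.
rewrite (E_projC k jf (sqi_proj k f)).
by rewrite proj_id; [apply: eq_E => x; rewrite mulrC|exact: chaos_proj].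
Qed.

Lemma E_sqr_chaos_sum K (F : 'I_K -> 'rV[R]_n -> R) :
  (forall k : 'I_K, chaos k (F k)) ->
  E (fun x => (\sum_k F k x) ^+ 2) = \sum_k E (fun x => F k x ^+ 2).
Proof.
move=> cF; have jF k := sqintg_polyfun (chaos_polyfun (cF k)).
rewrite (@eq_E _ _ _ _ _ (fun x => \sum_k \sum_l F k x * F l x)); last first.
  by move=> x; rewrite expr2 mulr_suml; apply: eq_bigr => k _; rewrite mulr_sumr.
rewrite E_sum; last by move=> k; apply: intg_sum => l; exact: intg_mul.
apply: eq_bigr => k _; rewrite E_sum; last by move=> l; exact: intg_mul.
rewrite (bigD1 k)//= big1 ?addr0; first by apply: eq_E => x; rewrite expr2.
by move=> l lk; apply: (chaos_orthogonal _ (cF k) (cF l)); rewrite eq_sym.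
Qed.

Lemma E_sqrB f g : sqi f -> sqi g ->
  E (fun x => (f x - g x) ^+ 2) =
  E (fun x => f x ^+ 2) - 2 * E (fun x => g x * f x) + E (fun x => g x ^+ 2).
Proof.
move=> jf jg; have [_ if2] := jf; have [_ ig2] := jg; have ifg := intg_mul jg jf.
rewrite -EZ// -EB//; last exact: intgZ.
rewrite -ED//; last by apply: intgB => //; exact: intgZ.
by apply: eq_E => x; ring.
Qed.

Lemma bessel K f : sqi f -> \sum_(k < K) energy k f <= E (fun x => f x ^+ 2).
Proof.
move=> jf; have jp := fun k : 'I_K => sqi_proj k f.
rewrite -subr_ge0.
have := E_ge0 (gauss R n) (fun x => sqr_ge0 (f x - \sum_(k < K) proj k f x)).
rewrite E_sqrB//; last exact: sqintg_sum.
rewrite E_sqr_chaos_sum; last by move=> k; exact: chaos_proj.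
rewrite (@eq_E _ _ _ _ (fun x => (\sum_(k < K) proj k f x) * f x)
  (fun x => \sum_(k < K) proj k f x * f x)); last by move=> x; rewrite mulr_suml.
rewrite E_sum; last by move=> k; exact: intg_mul.
under eq_bigr do rewrite E_proj_self//.
under [X in _ + X]eq_bigr do rewrite E_proj_sqr//.
by set a := \sum_(k < K) _; lra.
Qed.

(** Functions with a small [L^1] norm have little energy in low degree. For
    [F = proj k g] one has [energy k g = E(F g)], and
    [2 F g <= t F^2 |g| + |g| / t] for every [t > 0], where
    [E(F^2 |g|) <= E(F^4)^(1/2) E(g^2)^(1/2) <= 3^k * energy k g * E(g^2)^(1/2)]
    by hypercontractivity. The value [t = 1 / (3^k E(g^2)^(1/2))] gives the
    result. *)
Lemma energy_low_degree k g : sqi g ->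
  energy k g <= 3 ^+ k * Num.sqrt (E (fun x => g x ^+ 2)) * E (fun x => `|g x|).
Proof.
move=> jg; set b := Num.sqrt _; set N := E (fun x => `|g x|); set a := energy k g.
have a0 : 0 <= a by exact: energy_ge0.
have N0 : 0 <= N by exact: E_ge0.
have b0 : 0 <= b by exact: sqrtr_ge0.
have bb : b ^+ 2 = E (fun x => g x ^+ 2).
  by rewrite sqr_sqrtr//; apply: E_ge0 => x; exact: sqr_ge0.
set F := proj k g.
have pF : polyfun F by exact: chaos_polyfun (chaos_proj k g).
have jF := sqi_proj k g; have jF2 := sqintg_polyfun (polyfunX 2 pF).
have jng := sqintg_norm jg; have ing := sqintg_intg jng.
have h1 : E (fun x => F x ^+ 2 * `|g x|) <= 3 ^+ k * a * b.
  rewrite -(@ler_pXn2r _ 2)// ?nnegrE; last 2 first.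
  - by apply: E_ge0 => x; rewrite mulr_ge0 ?sqr_ge0.
  - by apply: mulr_ge0 => //; apply: mulr_ge0 => //; exact: exprn_ge0.
  apply: le_trans (E_cauchy_schwarz jF2 jng) _.
  rewrite exprMn bb; apply: ler_pM.
  - by apply: E_ge0 => x; rewrite sqr_ge0.
  - by apply: E_ge0 => x; rewrite sqr_ge0.
  - rewrite /a -E_proj_sqr//; apply: le_trans (chaos_hypercontractive (chaos_proj k g)).
    by rewrite le_eqVlt; apply/orP; left; apply/eqP/eq_E => x; rewrite -exprM.
  - rewrite le_eqVlt; apply/orP; left; apply/eqP/eq_E => x.
    by rewrite real_normK// num_real.
have h2 t : 0 < t -> 2 * a <= t * (3 ^+ k * a * b) + t^-1 * N.
  move=> t0.
  apply: (@le_trans _ _ (t * E (fun x => F x ^+ 2 * `|g x|) + t^-1 * N)); last first.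
    by rewrite lerD2r ler_wpM2l// ltW.
  rewrite /a -E_proj_self// -/F -EZ; last exact: intg_mul.
  rewrite -EZ; last exact: intg_mul.
  rewrite -EZ// -ED; [|by apply: intgZ; exact: intg_mul|exact: intgZ].
  apply: le_E.
  - by apply: intgZ; exact: intg_mul.
  - by apply: intgD; apply: intgZ => //; exact: intg_mul.
  move=> x; apply: (@le_trans _ _ (2 * (`|F x| * `|g x|))).
    by rewrite ler_wpM2l// -normrM ler_norm.
  rewrite -subr_ge0 -(real_normK (num_real (F x))).
  have -> : t * (`|F x| ^+ 2 * `|g x|) + t^-1 * `|g x| - 2 * (`|F x| * `|g x|) =
     t^-1 * `|g x| * (t * `|F x| - 1) ^+ 2 by field; rewrite gt_eqF.
  by apply: mulr_ge0; [apply: mulr_ge0 => //; rewrite invr_ge0 ltW|exact: sqr_ge0].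
have [b_eq0|b_neq0] := eqVneq b 0.
  have : a ^+ 2 <= b ^+ 2 * a.
    rewrite bb /a -{1}E_proj_self// -[X in _ <= _ * X]E_proj_sqr// mulrC.
    exact: E_cauchy_schwarz.
  by rewrite b_eq0 expr0n mul0r mulr0 mul0r expr2; nra.
have b_gt0 : 0 < b by rewrite lt_neqAle eq_sym b_neq0.
have k3 : 0 < 3 ^+ k :> R by rewrite exprn_gt0.
have := h2 (3 ^+ k * b)^-1; rewrite invr_gt0 mulr_gt0// => /(_ isT).
rewrite invrK.
have -> : (3 ^+ k * b)^-1 * (3 ^+ k * a * b) = a by field; rewrite b_neq0 gt_eqF.
lra.
Qed.

Definition chaos_decomposable F := exists (K : nat) (G : nat -> 'rV[R]_n -> R),
  (forall k, chaos k (G k)) /\ F = fun x => \sum_(k < K) G k x.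

Lemma sum_shift (D : nat -> R) K : D 0%N = 0 ->
  \sum_(k < K.+1) (if (k.+1 < K)%N then D k.+1 else 0) = \sum_(k < K) D k.
Proof.
move=> D0; case: K => [|K]; first by rewrite big_ord1 big_ord0.
rewrite 2!big_ord_recr/= ltnn (_ : (K.+2 < K.+1)%N = false); last first.
  by apply/negbTE; rewrite -leqNgt; exact: leqW.
rewrite !addr0 big_ord_recl D0 add0r.
by apply: eq_bigr => k _; rewrite ltnS ltn_ord.
Qed.

(** Multiplication by [x_i] is [raise i] plus [partial i], which move the chaos
    of order [k] to those of order [k + 1] and [k - 1]. *)
Lemma polyfun_chaos_decomposable F : polyfun F -> chaos_decomposable F.
Proof.
elim => [c|p1 p2 _ [K1 [G1 [c1 ->]]] _ [K2 [G2 [c2 ->]]]|i p _ [K [G [cG ->]]]].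
- exists 1%N, (fun k => if k is 0 then fun=> c else fun=> 0); split.
    by case=> [|k]; [exact: chaos_cst|exact: chaos0].
  by apply/funext => x; rewrite big_ord1.
- exists (maxn K1 K2), (fun k x => (if (k < K1)%N then G1 k x else 0) +
    (if (k < K2)%N then G2 k x else 0)); split.
    move=> k; apply: chaosD.
      by case: (k < K1)%N; [exact: c1|exact: chaos0].
    by case: (k < K2)%N; [exact: c2|exact: chaos0].
  apply/funext => x; rewrite big_split/=; congr (_ + _).
    rewrite (big_ord_widen _ (G1 ^~ x) (leq_maxl K1 K2)) big_mkcond/=.
    by apply: eq_bigr.
  rewrite (big_ord_widen _ (G2 ^~ x) (leq_maxr K1 K2)) big_mkcond/=.
  by apply: eq_bigr.
- exists K.+1, (fun k x =>
      (if k is k'.+1 then if (k' < K)%N then raise i (G k') x else 0 else 0) +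
      (if (k.+1 < K)%N then partial i (G k.+1) x else 0)); split.
    move=> k; apply: chaosD.
      case: k => [|k]; first exact: chaos0.
      by case: (k < K)%N; [exact/chaos_raise/cG|exact: chaos0].
    by case: (k.+1 < K)%N; [exact/chaos_partial/cG|exact: chaos0].
  apply/funext => x; rewrite big_split/= big_ord_recl/= add0r.
  rewrite (@sum_shift (fun k => partial i (G k) x)); last first.
    by have [_ _ [c ->]] := cG 0%N; rewrite partial_cst.
  rewrite mulr_sumr -big_split/=; apply: eq_bigr => k _.
  by rewrite add0n ltn_ord /raise subrK.
Qed.

(** The quantitative half of Parseval's identity: the energy of [f] missed by the
    first [K] chaoses is at most its squared distance to a polynomial [F] lying
    in their sum. Writing [F = sum_k G_k], the difference of both sides is
    [sum_k E((proj k f - G_k)^2)]. *)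
Lemma energy_approx F f : polyfun F -> sqi f -> exists K,
  E (fun x => f x ^+ 2) <=
  \sum_(k < K) energy k f + E (fun x => (f x - F x) ^+ 2).
Proof.
move=> /polyfun_chaos_decomposable[K [G [cG ->]]] jf.
have jG k := sqintg_polyfun (chaos_polyfun (cG k)).
exists K; rewrite E_sqrB//; last by apply: sqintg_sum => k; exact: jG.
rewrite E_sqr_chaos_sum; last by move=> k; exact: cG.
rewrite (@eq_E _ _ _ _ (fun x => (\sum_(k < K) G k x) * f x)
  (fun x => \sum_(k < K) G k x * f x)); last by move=> x; rewrite mulr_suml.
rewrite E_sum; last by move=> k; exact: intg_mul.
suff : 0 <= \sum_(k < K) (energy k f - 2 * E (fun x => G k x * f x) +
                          E (fun x => G k x ^+ 2)).
  rewrite big_split/= sumrB -mulr_sumr.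
  by set a := \sum_(k < K) _; set b := \sum_(k < K) _; set c := \sum_(k < K) _; lra.
apply: sumr_ge0 => k _; rewrite -E_proj_sqr//.
have -> : E (fun x => G k x * f x) = E (fun x => G k x * proj k f x).
  by rewrite -{1}(proj_id (cG k)) E_projC.
rewrite -E_sqrB//; last exact: sqi_proj.
by apply: E_ge0 => x; exact: sqr_ge0.
Qed.

End chaos.

(** * Density of polynomial functions in L^2 *)

Section sequences.
Context (R : realType).

Lemma bernoulli_lower (a : R) N : 0 <= a <= 1 -> 1 - N%:R * a <= (1 - a) ^+ N.
Proof.
move=> /andP[a0 a1]; elim: N => [|N ih]; first by rewrite mul0r subr0.
rewrite exprS; apply: (@le_trans _ _ ((1 - a) * (1 - N%:R * a))).
  by rewrite -natr1; have : 0 <= N%:R :> R by []; nra.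
by rewrite ler_wpM2l// subr_ge0.
Qed.

Lemma bernoulli_upper (a : R) N : 0 <= a <= 1 -> (1 - a) ^+ N * (1 + N%:R * a) <= 1.
Proof.
move=> /andP[a0 a1]; elim: N => [|N ih]; first by rewrite mul0r addr0 mulr1.
apply: le_trans ih; rewrite exprSr -mulrA ler_wpM2l ?exprn_ge0 ?subr_ge0//.
by rewrite -natr1; have : 0 <= N%:R :> R by []; nra.
Qed.

(** With [y = z^(1/2)], the sequence [m * y^m] is bounded by Bernoulli's
    inequality, so [m * z^m = m * y^m * y^m] tends to [0]. *)
Lemma cvg_mulrn_expr (z : R) : 0 <= z < 1 ->
  (fun m => m%:R * z ^+ m) @ \oo --> (0 : R).
Proof.
move=> /andP[z0 z1]; pose y := Num.sqrt z.
have y0 : 0 <= y by exact: sqrtr_ge0.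
have yy : y ^+ 2 = z by rewrite sqr_sqrtr.
have y1 : y < 1 by rewrite -(@ltr_pXn2r _ 2)// ?nnegrE// yy expr1n.
have [y_eq0|y_neq0] := eqVneq y 0.
  have -> : (fun m => m%:R * z ^+ m) = fun=> 0 :> R; last exact: cvg_cst.
  apply/funext => -[|m]; first by rewrite mul0r.
  by rewrite -yy y_eq0 !expr0n mulr0.
have y_gt0 : 0 < y by rewrite lt_neqAle eq_sym y_neq0.
have bound m : m%:R * z ^+ m <= (1 - y)^-1 * y ^+ m.
  have a01 : 0 <= 1 - y <= 1 by apply/andP; split; lra.
  have := bernoulli_upper m a01; rewrite subKr => h.
  rewrite -yy -exprM mulnC exprM expr2 mulrA ler_wpM2r ?exprn_ge0//.
  rewrite -[leRHS]mul1r ler_pdivlMr ?subr_gt0//.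
  apply: le_trans h; rewrite mulrAC [leRHS]mulrC.
  by rewrite ler_wpM2r ?exprn_ge0// lerDr.
apply: (@squeeze_cvgr _ _ _ _ (fun=> 0) (fun m => (1 - y)^-1 * y ^+ m)).
- by apply: nearW => m; rewrite bound andbT mulr_ge0// exprn_ge0.
- exact: cvg_cst.
- rewrite -(mulr0 (1 - y)^-1); apply: cvgM; first exact: cvg_cst.
  by apply: cvg_expr; rewrite ger0_norm.
Qed.

(** Polynomials in [u] that converge on the whole of [[0, 1]] to a step function.
    The exponent [2^m] alone leaves the limit [1 / e] at [u = 1 / 2]; the extra
    factor [m] makes it [0] there. *)
Lemma cvg_threshold (u : R) : 0 <= u <= 1 ->
  (fun m => (1 - u ^+ m) ^+ (m * 2 ^ m)) @ \oo --> ((u < 2^-1)%R%:R : R).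
Proof.
move=> /andP[u0 u1].
have um m : 0 <= u ^+ m <= 1 by rewrite exprn_ge0//= exprn_ile1.
have Nu m : (m * 2 ^ m)%:R * u ^+ m = m%:R * (2 * u) ^+ m.
  by rewrite natrM natrX exprMn mulrA.
have [uh|uh] := ltP u 2^-1.
  apply: (@squeeze_cvgr _ _ _ _ (fun m => 1 - m%:R * (2 * u) ^+ m) (fun=> 1)).
  - apply: nearW => m; rewrite -Nu bernoulli_lower//=.
    by have /andP[a0 a1] := um m; rewrite exprn_ile1// ?subr_ge0// gerBl.
  - rewrite -[X in _ --> X]subr0; apply: cvgB; first exact: cvg_cst.
    by apply: cvg_mulrn_expr; apply/andP; split; lra.
  - exact: cvg_cst.
apply: (@squeeze_cvgr _ _ _ _ (fun=> 0) (fun m => m.+1%:R^-1)).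
- apply: nearW => m; have /andP[a0 a1] := um m.
  rewrite exprn_ge0 ?subr_ge0//= -[leRHS]mul1r ler_pdivlMr//.
  apply: le_trans (bernoulli_upper (m * 2 ^ m) (um m)).
  rewrite ler_wpM2l ?exprn_ge0 ?subr_ge0// Nu -natr1 addrC lerD2l.
  by rewrite ler_peMr// exprn_ege1//; lra.
- exact: cvg_cst.
- exact: cvg_harmonic.
Qed.

Lemma norm_exp_series (t : R) m : 0 <= t -> `|series (exp_coeff (- t)) m| <= expR t.
Proof.
move=> t0; rewrite /series/=; apply: le_trans (ler_norm_sum _ _ _) _.
rewrite (eq_bigr (exp_coeff t)); last first.
  move=> k _; rewrite /exp_coeff/= normrM normrX normrN normfV !ger0_norm//.
rewrite /expR; apply: (@nondecreasing_cvgn_le _ (series (exp_coeff t))).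
  by apply: nondecreasing_series => k _ _; exact: exp_coeff_ge0.
exact: is_cvg_series_exp_coeff.
Qed.

Lemma cvg_exp_series (t : R) : series (exp_coeff t) @ \oo --> expR t.
Proof. exact: is_cvg_series_exp_coeff. Qed.

End sequences.

Section density.
Context (R : realType) (n : nat).
Implicit Types (p q f g u v : 'rV[R]_n -> R) (i j : 'I_n) (x : 'rV[R]_n).
Local Notation E f := (\int[gauss R n]_x f x).
Local Notation sqi := (sqintg (gauss R n)).
Local Notation mfun f := (measurable_fun [set: 'rV[R]_n] f).

(** Membership in the [L^2] closure of polynomial functions. *)
Definition approx f := forall e, 0 < e ->
  exists p, polyfun p /\ E (fun x => (f x - p x) ^+ 2) < e.

Lemma E_sqrB_triangle f g h : sqi f -> sqi g -> sqi h ->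
  E (fun x => (f x - h x) ^+ 2) <=
  2 * E (fun x => (f x - g x) ^+ 2) + 2 * E (fun x => (g x - h x) ^+ 2).
Proof.
move=> jf jg jh.
have [_ i1] := sqintgB jf jg; have [_ i2] := sqintgB jg jh.
have [_ i3] := sqintgB jf jh.
rewrite -!EZ// -ED; [|exact: intgZ|exact: intgZ].
apply: le_E => //; first by apply: intgD; exact: intgZ.
move=> x; rewrite -subr_ge0.
have -> : 2 * (f x - g x) ^+ 2 + 2 * (g x - h x) ^+ 2 - (f x - h x) ^+ 2 =
  (f x - g x - (g x - h x)) ^+ 2 by ring.
exact: sqr_ge0.
Qed.

Lemma approx_lim f : sqi f ->
  (forall e, 0 < e -> exists g,
    [/\ sqi g, approx g & E (fun x => (f x - g x) ^+ 2) < e]) ->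
  approx f.
Proof.
move=> jf fg e e0; have e40 : 0 < e / 4 by rewrite divr_gt0.
have [g [jg ag fge]] := fg _ e40; have [p [pp gpe]] := ag _ e40.
exists p; split => //.
apply: le_lt_trans (E_sqrB_triangle jf jg (sqintg_polyfun pp)) _.
lra.
Qed.

Lemma approx_polyfun p : polyfun p -> approx p.
Proof.
move=> pp e e0; exists p; split => //.
rewrite (@eq_E _ _ _ _ _ (fun=> 0)); last by move=> x; rewrite subrr expr0n.
by rewrite (_ : E (fun=> 0) = 0)//; exact: E_cst.
Qed.

Lemma approxZ c f : sqi f -> approx f -> approx (fun x => c * f x).
Proof.
move=> jf af e e0; have c0 : 0 < c ^+ 2 + 1 by rewrite ltr_pwDr// sqr_ge0.
have [p [pp fp]] := af (e / (c ^+ 2 + 1)) (divr_gt0 e0 c0).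
exists (fun x => c * p x); split; first exact: polyfunZ.
have [_ i1] := sqintgB jf (sqintg_polyfun pp).
rewrite (@eq_E _ _ _ _ _ (fun x => c ^+ 2 * (f x - p x) ^+ 2)); last by move=> x; ring.
rewrite EZ//; move: fp; rewrite ltr_pdivlMr//.
have : 0 <= E (fun x => (f x - p x) ^+ 2) by apply: E_ge0 => x; exact: sqr_ge0.
by set a := Rintegral _ _ _; nra.
Qed.

Lemma approxD f g : sqi f -> sqi g -> approx f -> approx g ->
  approx (fun x => f x + g x).
Proof.
move=> jf jg af ag e e0; have e40 : 0 < e / 4 by rewrite divr_gt0.
have [p [pp fp]] := af _ e40; have [q [pq gq]] := ag _ e40.
exists (fun x => p x + q x); split; first exact: polyfunD.
have jp := sqintg_polyfun pp; have jq := sqintg_polyfun pq.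
apply: le_lt_trans (E_sqrB_triangle (sqintgD jf jg) (sqintgD jp jg) (sqintgD jp jq)) _.
rewrite (@eq_E _ _ _ _ _ (fun x => (f x - p x) ^+ 2)); last by move=> x; ring.
rewrite (@eq_E _ _ _ _ (fun x => (p x + g x - (p x + q x)) ^+ 2)
                        (fun x => (g x - q x) ^+ 2)); last by move=> x; ring.
lra.
Qed.

Lemma approx_sum I (s : seq I) (F : I -> 'rV[R]_n -> R) :
  (forall k, sqi (F k)) -> (forall k, approx (F k)) ->
  approx (fun x => \sum_(k <- s) F k x).
Proof.
move=> jF aF; elim: s => [|k s ih].
  rewrite (_ : (fun x => _) = fun=> 0); first exact/approx_polyfun/polyfun_cst.
  by apply/funext => x; rewrite big_nil.
rewrite (_ : (fun x => _) = fun x => F k x + \sum_(l <- s) F l x).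
  by apply: approxD => //; exact: sqintg_sum.
by apply/funext => x; rewrite big_cons.
Qed.

(** The bounded functions that multiply polynomials into their closure form an
    algebra closed under bounded pointwise limits, unlike the closure itself,
    which is not stable under products. *)
Definition multiplier u := [/\ mfun u, exists M, forall x, `|u x| <= M &
  forall p, polyfun p -> approx (fun x => u x * p x)].

Lemma sqi_bounded_mul u f : mfun u -> (exists M, forall x, `|u x| <= M) -> sqi f ->
  sqi (fun x => u x * f x).
Proof.
move=> mu [M uM] jf; have [mf _] := jf.
apply: (sqintg_le _ (sqintgZ M (sqintg_norm jf))); first exact: measurable_funM.
by move=> x; rewrite normrM ler_wpM2r.
Qed.

Lemma sqi_multiplier u f : multiplier u -> sqi f -> sqi (fun x => u x * f x).
Proof. by move=> [mu bu _]; exact: sqi_bounded_mul. Qed.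

Lemma multiplier_lim (u_ : nat -> 'rV[R]_n -> R) u M :
  (forall k, multiplier (u_ k)) -> (forall k x, `|u_ k x| <= M) -> mfun u ->
  (forall x, u_ ^~ x @ \oo --> u x) -> multiplier u.
Proof.
move=> mu_ u_M mu cu.
have uM x : `|u x| <= M.
  have nu : (fun k => `|u_ k x|) @ \oo --> `|u x| by exact: cvg_norm (cu x).
  rewrite -(cvg_lim _ nu)//; apply: limr_le; last by apply: nearW => k; exact: u_M.
  by apply/cvg_ex; eexists; exact: nu.
split=> // [|p pp]; first by exists M.
have jp := sqintg_polyfun pp; have [mp _] := jp.
have bu : exists M, forall x, `|u x| <= M by exists M.
apply: approx_lim => [|e e0]; first exact: sqi_bounded_mul.
have [k_|||||k ke] := @dominated_sqE _ _ _ (gauss R n)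
  (fun k x => u_ k x * p x) (fun x => u x * p x)
  (fun x => M * `|p x|) _ _ _ _ _ e e0.
- by have [mk _ _] := mu_ k_; exact: measurable_funM.
- exact: measurable_funM.
- exact/sqintgZ/sqintg_norm.
- by move=> k x; rewrite normrM ler_wpM2r.
- by move=> x; apply: cvgM; [exact: cu|exact: cvg_cst].
exists (fun x => u_ k x * p x); split => //; first exact: sqi_multiplier.
by have [_ _] := mu_ k; exact.
Qed.

Lemma multiplierM u v : multiplier u -> multiplier v -> multiplier (fun x => u x * v x).
Proof.
move=> hu hv; have [mu [M uM] au] := hu; have [mv [M' vM] av] := hv.
have bu : exists M, forall x, `|u x| <= M by exists M.
split; first exact: measurable_funM.
  by exists (M * M') => x; rewrite normrM ler_pM.
move=> p pp; have jp := sqintg_polyfun pp.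
have jvp := sqi_multiplier hv jp.
rewrite (_ : (fun x => u x * v x * p x) = fun x => u x * (v x * p x)); last first.
  by apply/funext => x; rewrite mulrA.
apply: approx_lim => [|e e0]; first exact: sqi_multiplier.
have M0 : 0 < M ^+ 2 + 1 by rewrite ltr_pwDr// sqr_ge0.
have [q [pq vpq]] := av p pp (e / (M ^+ 2 + 1)) (divr_gt0 e0 M0).
have jq := sqintg_polyfun pq.
exists (fun x => u x * q x); split; [exact: sqi_multiplier|exact: au|].
have [_ i1] := sqintgB jvp jq.
have i2 : intg (gauss R n) (fun x => (u x * (v x * p x) - u x * q x) ^+ 2).
  by have [] := sqintgB (sqi_multiplier hu jvp) (sqi_multiplier hu jq).
apply: (@le_lt_trans _ _ (E (fun x => M ^+ 2 * (v x * p x - q x) ^+ 2))).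
  apply: le_E => //; first exact: intgZ.
  move=> x; rewrite -mulrBr exprMn ler_wpM2r ?sqr_ge0//.
  by rewrite -(real_normK (num_real (u x))) lerXn2r// nnegrE (le_trans _ (uM x)).
rewrite EZ//; move: vpq; rewrite ltr_pdivlMr//.
have : 0 <= E (fun x => (v x * p x - q x) ^+ 2) by apply: E_ge0 => x; exact: sqr_ge0.
by set a := Rintegral _ _ _; nra.
Qed.

Lemma multiplier_cst c : multiplier (fun=> c).
Proof.
split; first exact: measurable_cst.
  by exists (`|c|).
by move=> p pp; apply/approx_polyfun/polyfunZ.
Qed.

Lemma multiplierD u v : multiplier u -> multiplier v -> multiplier (fun x => u x + v x).
Proof.
move=> hu hv; have [mu [M uM] au] := hu; have [mv [M' vM] av] := hv.
split; first exact: measurable_funD.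
  by exists (M + M') => x; rewrite (le_trans (ler_normD _ _))// lerD.
move=> p pp; have jp := sqintg_polyfun pp.
rewrite (_ : (fun x => _) = fun x => u x * p x + v x * p x); last first.
  by apply/funext => x; rewrite mulrDl.
by apply: approxD; [exact: sqi_multiplier|exact: sqi_multiplier|exact: au|exact: av].
Qed.

Lemma multiplier_onem u : multiplier u -> multiplier (fun x => 1 - u x).
Proof.
move=> hu.
have := multiplierD (multiplier_cst 1) (multiplierM (multiplier_cst (-1)) hu).
by congr multiplier; apply/funext => x; ring.
Qed.

Lemma multiplierX u k : multiplier u -> multiplier (fun x => u x ^+ k).
Proof.
move=> hu; elim: k => [|k ih]; first exact: (multiplier_cst 1).
by have := multiplierM hu ih; congr multiplier; apply/funext => x; rewrite exprS.
Qed.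

Lemma coord_sqr_le x i : x 0 i ^+ 2 <= sqnorm x.
Proof.
by rewrite /sqnorm (bigD1 i)//= lerDl sumr_ge0// => k _; exact: sqr_ge0.
Qed.

(** The Taylor polynomials of the bump [e^(-t)], with [t = (x_i - y)^2 / 32],
    are bounded by [e^t], and [t <= (x_i^2 + y^2) / 16]. The width [32] is large
    enough for [e^t] times a polynomial to be square-integrable, so that
    dominated convergence applies. *)
Lemma multiplier_gaussian i (y : R) :
  multiplier (fun x => expR (- (32^-1 * (x 0 i - y) ^+ 2))).
Proof.
pose t x := 32^-1 * (x 0 i - y) ^+ 2.
have pt : polyfun t.
  by apply: polyfunZ; apply: polyfunX; apply: polyfunB;
    [exact: polyfun_coord|exact: polyfun_cst].
have t0 x : 0 <= t x by rewrite mulr_ge0 ?sqr_ge0.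
have mt : mfun t by exact: measurable_polyfun.
have mu : mfun (fun x => expR (- t x)).
  by apply: measurableT_comp => //; exact: measurableT_comp.
have u1 x : `|expR (- t x)| <= 1.
  by rewrite ger0_norm ?expR_ge0// -expR0 ler_expR oppr_le0.
split=> //; first by exists 1.
move=> p pp; have jp := sqintg_polyfun pp; have [mp _] := jp.
have ps k : polyfun (fun x => series (exp_coeff (- t x)) k).
  rewrite /series/=; apply: polyfun_sum => l; rewrite /exp_coeff/=.
  have := polyfunZ (l`!%:R^-1) (polyfunX l (polyfunZ (-1) pt)).
  by apply: eq_polyfun => x; rewrite mulN1r mulrC.
have [|C [C0 pC]] := polyfun_growth pp (d := 16^-1); first by rewrite invr_gt0.
have bu : exists M, forall x, `|expR (- t x)| <= M by exists 1.
apply: approx_lim => [|e e0]; first exact: sqi_bounded_mul.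
have [k_|||||k ke] := @dominated_sqE _ _ _ (gauss R n)
  (fun k x => series (exp_coeff (- t x)) k * p x) (fun x => expR (- t x) * p x)
  (fun x => expR (16^-1 * y ^+ 2) * C * expR (8^-1 * sqnorm x)) _ _ _ _ _ e e0.
- by apply: measurable_funM => //; exact: measurable_polyfun.
- exact: measurable_funM.
- exact/sqintgZ/sqintg_expR_sqnorm.
- move=> k x; rewrite normrM.
  apply: (@le_trans _ _ (expR (t x) * (C * expR (16^-1 * sqnorm x)))).
    by rewrite ler_pM// norm_exp_series.
  rewrite mulrCA [_ * C]mulrC -!mulrA ler_wpM2l// -!expRD ler_expR.
  rewrite /t; have := coord_sqr_le x i; have := sqr_ge0 (x 0 i + y).
  rewrite !expr2; nra.
- by move=> x; apply: cvgM; [exact: cvg_exp_series|exact: cvg_cst].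
exists (fun x => series (exp_coeff (- t x)) k * p x); split => //.
  by apply: sqintg_polyfun; exact: polyfunM.
by apply: approx_polyfun; exact: polyfunM.
Qed.

Definition mulset (S : set 'rV[R]_n) := multiplier (\1_S : 'rV[R]_n -> R).

Lemma mulset_lt_half u : multiplier u -> (forall x, 0 <= u x <= 1) ->
  mulset [set x | u x < 2^-1].
Proof.
move=> hu u01; have [mu _ _] := hu.
apply: (@multiplier_lim (fun m x => (1 - u x ^+ m) ^+ (m * 2 ^ m)) _ 1).
- by move=> k; apply/multiplierX/multiplier_onem/multiplierX.
- move=> k x; have /andP[u0 u1] := u01 x.
  have h : 0 <= 1 - u x ^+ k <= 1.
    by rewrite subr_ge0 exprn_ile1//= gerBl exprn_ge0.
  have /andP[h0 h1] := h.
  by rewrite ger0_norm ?exprn_ge0// exprn_ile1.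
- apply: measurable_indic.
  rewrite -[X in measurable X]setTI.
  have mlt : measurable_fun setT (fun x => u x < 2^-1).
    by apply: measurable_fun_ltr => //; exact: measurable_cst.
  exact: (mlt measurableT [set true]).
- move=> x; rewrite indicE; have := cvg_threshold (u01 x).
  by rewrite (_ : (x \in _) = (u x < 2^-1))//; apply/idP/idP => [/set_mem|/mem_set].
Qed.

Lemma mulset_setC S : mulset S -> mulset (~` S).
Proof.
move=> /multiplier_onem; congr multiplier; apply/funext => x.
by rewrite !indicE in_setC; case: (x \in S); rewrite /= ?subrr ?subr0.
Qed.

Lemma measurable_mulset S : mulset S -> measurable S.
Proof.
move=> [mS _ _]; have := mS measurableT [set 1] (measurable_set1 _).
rewrite setTI; congr measurable; apply/seteqP; split => x /=; rewrite indicE.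
  by have [|_ /eqP] := boolP (x \in S); [rewrite inE|rewrite eq_sym oner_eq0].
by move=> Sx; rewrite mem_set.
Qed.

(** Complements of finite unions correspond to products of multipliers, and
    countable unions to bounded pointwise limits. *)
Lemma mulset_bigcup (S : nat -> set 'rV[R]_n) : (forall k, mulset (S k)) ->
  mulset (\bigcup_k S k).
Proof.
move=> hS.
apply: (@multiplier_lim (fun m x => 1 - \prod_(k < m) (1 - \1_(S k) x)) _ 1).
- move=> m; apply: multiplier_onem.
  elim: m => [|m ih].
    by have := multiplier_cst 1; congr multiplier; apply/funext => x; rewrite big_ord0.
  have := multiplierM ih (multiplier_onem (hS m)).
  by congr multiplier; apply/funext => x; rewrite big_ord_recr.
- move=> m x.
  have /andP[p0 p1] : 0 <= \prod_(k < m) (1 - \1_(S k) x : R) <= 1.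
    apply/andP; split.
      by apply: prodr_ge0 => k _; rewrite subr_ge0 indicE lern1 leq_b1.
    by apply: prodr_ile1 => k _; rewrite subr_ge0 gerBl indicE lern1 leq_b1 ler0n.
  by rewrite ger0_norm ?subr_ge0// gerBl.
- by apply: measurable_indic; apply: bigcupT_measurable => k; exact: measurable_mulset.
- move=> x; rewrite indicE.
  have [|xS] := boolP (x \in \bigcup_k S k).
    rewrite inE => -[k _ Skx].
    apply: (@cvg_trans _ ((fun=> 1 : R) @ \oo)); last exact: cvg_cst.
    apply: near_eq_cvg; exists k.+1 => // m /= km.
    by rewrite (bigD1 (Ordinal km))//= indicE mem_set// subrr mul0r subr0.
  rewrite (_ : (fun m => _) = fun=> 0); first exact: cvg_cst.
  apply/funext => m; rewrite big1 ?subrr// => k _.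
  rewrite indicE memNset ?subr0// => Skx.
  by move: xS; rewrite notin_setE; apply; exists k.
Qed.

Lemma sigma_algebra_mulset : sigma_algebra setT mulset.
Proof.
split.
- by have := multiplier_cst 0; congr multiplier; apply/funext => x; rewrite indic0.
- by move=> S hS; rewrite setTD; exact: mulset_setC.
- exact: mulset_bigcup.
Qed.

(** The band is where the bump centered at [y] is at least [1 / 2]. *)
Lemma mulset_band i (y : R) :
  mulset [set x | `|x 0 i - y| <= Num.sqrt (32 * ln 2)].
Proof.
set r := Num.sqrt _.
have r0 : 0 <= r by exact: sqrtr_ge0.
have rr : r ^+ 2 = 32 * ln 2 by rewrite sqr_sqrtr// mulr_ge0// ln_ge0// ler1n.
have u01 x : 0 <= expR (- (32^-1 * (x 0 i - y) ^+ 2)) <= 1.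
  by rewrite expR_ge0/= -expR0 ler_expR oppr_le0 mulr_ge0// sqr_ge0.
have h x : (expR (- (32^-1 * (x 0 i - y) ^+ 2)) < 2^-1) = ~~ (`|x 0 i - y| <= r).
  rewrite -ltNge -[2^-1]lnK ?posrE// ltr_expR lnV ?posrE// ltrN2.
  rewrite -[RHS](@ltr_pXn2r _ 2)// ?nnegrE// rr real_normK ?num_real//.
  by rewrite mulrC ltr_pdivlMr// [ln 2 * _]mulrC.
have := mulset_setC (mulset_lt_half (multiplier_gaussian i y) u01).
congr mulset; apply/seteqP; split => x /=; rewrite h.
  by move=> /negP; rewrite negbK.
by move=> xr; apply/negP; rewrite negbK.
Qed.

(** A half-space is tiled by countably many bands of the same width. *)
Lemma mulset_ray i (a : R) : mulset [set x | a <= x 0 i].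
Proof.
pose r : R := Num.sqrt (32 * ln 2).
have r_gt0 : 0 < r.
  by rewrite sqrtr_gt0 mulr_gt0// ln_gt0// ltr1n.
rewrite (_ : [set x | a <= x 0 i] =
  \bigcup_k [set x | `|x 0 i - (a + (2 * k%:R + 1) * r)| <= r]).
  by apply: mulset_bigcup => k; exact: mulset_band.
apply/seteqP; split => x /=.
- move=> ax; exists (Num.truncn ((x 0 i - a) / (2 * r))) => //=.
  have t0 : 0 <= (x 0 i - a) / (2 * r).
    by rewrite divr_ge0 ?subr_ge0// mulr_ge0// ltW.
  have /andP := truncn_itv t0.
  set k := Num.truncn _; rewrite ler_pdivlMr ?mulr_gt0// ltr_pdivrMr ?mulr_gt0//.
  by rewrite -natr1 => -[h1 h2]; rewrite ler_norml; apply/andP; split; nra.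
- move=> [k _] /=; rewrite ler_norml => /andP[h _].
  have : 0 <= k%:R * r by rewrite mulr_ge0// ltW.
  by nra.
Qed.

Lemma measurable_is_mulset S : measurable S -> mulset S.
Proof.
suff : g_sigma_preimage (fun i (x : 'rV[R]_n) => x 0 i : measurableTypeR R)
    `<=` mulset by apply.
apply: smallest_sub; first exact: sigma_algebra_mulset.
rewrite -bigcup_seq => _ [i _ [B mB <-]]; rewrite setTI.
have [m0 _ _] := sigma_algebra_mulset.
pose good := [set B : set R | mulset ((fun x : 'rV[R]_n => x 0 i) @^-1` B)].
suff : (@ocitv R).-sigma.-measurable `<=` good by apply.
rewrite RGenCInfty.measurableE.
apply: smallest_sub; first split.
- by rewrite /good/= preimage_set0.
- by move=> A hA; rewrite /good/= setTD preimage_setC; exact: mulset_setC.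
- by move=> A hA; rewrite /good/= preimage_bigcup; exact: mulset_bigcup.
move=> _ [a ->]; have := mulset_ray i a; rewrite /good/=; congr mulset.
by apply/seteqP; split => x /=; rewrite in_itv/= andbT.
Qed.

Lemma approx_indic S : measurable S -> approx (\1_S : 'rV[R]_n -> R).
Proof.
move=> /measurable_is_mulset[_ _ /(_ _ (@polyfun_cst R n 1))].
by congr approx; apply/funext => x; rewrite mulr1.
Qed.

Lemma sqi_indic S : measurable S -> sqi (\1_S : 'rV[R]_n -> R).
Proof.
move=> mS; apply: sqintg_le (sqintg_cst _ 1) _; first exact: measurable_indic.
by move=> x; rewrite ger0_norm// indicE lern1 leq_b1.
Qed.

Import HBSimple HBNNSimple.

Lemma approx_sfun (g : {nnsfun 'rV[R]_n >-> R}) : approx g.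
Proof.
rewrite (funext (fimfunEord g)).
have mg (l : R) : measurable (g @^-1` [set l]).
  by rewrite -[X in measurable X]setTI; exact: measurable_funP.
apply: approx_sum => l; first exact/sqintgZ/sqi_indic.
by apply: approxZ; [exact: sqi_indic|exact: approx_indic].
Qed.

Lemma approx_ge0 f : sqi f -> (forall x, 0 <= f x) -> approx f.
Proof.
move=> jf f0; have [mf _] := jf.
have mEf : measurable_fun setT (EFin \o f) by exact/measurable_EFinP.
pose g k : {nnsfun 'rV[R]_n >-> R} := nnsfun_approx measurableT mEf k.
have f0' x : setT x -> (0 <= (EFin \o f) x)%E by rewrite lee_fin.
apply: approx_lim => // e e0.
have gf k x : `|g k x| <= f x.
  rewrite ger0_norm// -lee_fin /g nnsfun_approxE.
  exact: (le_approx k f0').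
have mg k : mfun (g k) by exact: measurable_funP.
have [|||k ke] := @dominated_sqE _ _ _ (gauss R n) (fun k => g k) f f _ mf jf _ _ e e0.
- by [].
- by [].
- move=> x; rewrite /g; under eq_fun do rewrite nnsfun_approxE.
  exact: (cvg_approx f0' I (ltry _)).
exists (g k); split => //; last exact: approx_sfun.
exact: sqintg_le jf (gf k).
Qed.

(** Every measurable set has a multiplier as its indicator function, hence the
    closure contains simple functions, and then all of [L^2]. *)
Lemma polyfun_dense f : sqi f -> approx f.
Proof.
move=> jf; have [mf _] := jf; have jn := sqintg_norm jf.
have jp : sqi (fun x => Num.max (f x) 0).
  apply: (sqintg_le _ jn); first exact: measurable_maxr.
  by move=> x; have [fx|fx] := ltP (f x) 0; rewrite ?normr0.
have jm : sqi (fun x => Num.max (- f x) 0).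
  apply: (sqintg_le _ jn).
    by apply: measurable_maxr => //; exact: measurableT_comp.
  by move=> x; have [fx|fx] := ltP (- f x) 0; rewrite ?normr0 ?normrN.
rewrite (_ : f = fun x => Num.max (f x) 0 + (-1) * Num.max (- f x) 0); last first.
  by apply/funext => x; have [h1|h1] := ltP (f x) 0; have [h2|h2] := ltP (- f x) 0; lra.
apply: approxD => //; first exact: sqintgZ.
  by apply: approx_ge0 => // x; rewrite le_max lexx orbT.
apply: approxZ => //.
by apply: approx_ge0 => // x; rewrite le_max lexx orbT.
Qed.

End density.

(** * The logarithmic gain and the theorem *)

Section weights.
Context (R : realType).

Lemma sum_pow3_le (K m : nat) :
  \sum_(k < K) (if (k < m)%N then 3 ^+ k else 0) <= 3 ^+ minn K m :> R.
Proof.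
elim: K => [|K ih]; first by rewrite big_ord0 exprn_ge0.
rewrite big_ord_recr/=; case: ltnP => Km.
  rewrite (minn_idPl Km) (le_trans (lerD ih (lexx _)))//.
  rewrite (minn_idPl (ltnW Km)) exprS.
  have : 0 <= 3 ^+ K :> R by rewrite exprn_ge0.
  by set t := 3 ^+ K; lra.
by rewrite addr0 (minn_idPr (leqW Km)) -{2}(minn_idPr Km).
Qed.

(** Since [3 <= e^2], the left-hand side is at most [e^(-L/2)], and
    [e^(L/2) >= ((1 + L) / 4)^2]. *)
Lemma pow3_decay (L : R) (m : nat) : 0 <= L -> m%:R <= L / 4 ->
  3 ^+ m * expR (- L) <= 16 / (1 + L) ^+ 2.
Proof.
move=> L0 mL.
have e3 : 3 ^+ m <= expR (L / 2).
  apply: (@le_trans _ _ (expR (m%:R * 2))).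
    rewrite expRM_natl lerXn2r ?nnegrE ?expR_ge0//.
    rewrite (_ : 2 = 1 + 1 :> R)// expRD.
    by have := expR_ge1Dx (1 : R); nra.
  by rewrite ler_expR; lra.
have q : (1 + L) / 4 <= expR (L / 4).
  by apply: le_trans (expR_ge1Dx _); lra.
have qq : ((1 + L) / 4) ^+ 2 <= expR (L / 2).
  rewrite [L / 2](_ : _ = L / 4 + L / 4); last by field.
  by rewrite expRD expr2 ler_pM// divr_ge0// addr_ge0.
apply: (@le_trans _ _ (expR (L / 2) * expR (- L))).
  by rewrite ler_wpM2r ?expR_ge0.
rewrite -expRD [L / 2 + _](_ : _ = - (L / 2)); last by field.
rewrite expRN ler_pdivlMr; last by rewrite exprn_gt0// ltr_pwDl.
rewrite mulrC ler_pdivrMr ?expR_gt0//.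
move: qq; rewrite exprMn exprVn; set e := expR _; lra.
Qed.

(** With [L = ln (b / N)], the sum is cut at [m], the integer part of [L / 4].
    Below [m] the third hypothesis contributes at most [3^m b N = b^2 3^m e^(-L)]
    and above [m] the weights are at most [1 / (m + 1)^2], while the [a k] sum
    up to [b^2]. Both contributions are of order [b^2 / (1 + L)^2]. *)
Lemma weighted_sum_bound (a : nat -> R) (K : nat) (b N : R) :
  (forall k, 0 <= a k) -> 0 <= N <= b ->
  (forall k, a k <= 3 ^+ k * b * N) -> \sum_(k < K) a k <= b ^+ 2 ->
  \sum_(k < K) a k / (k.+1%:R * k.+2%:R) <= 41 * (b ^+ 2 / (1 + ln (b / N)) ^+ 2).
Proof.
move=> a0 /andP[N0 Nb] aN ab.
have rhs0 : 0 <= 41 * (b ^+ 2 / (1 + ln (b / N)) ^+ 2).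
  by rewrite mulr_ge0// divr_ge0// sqr_ge0.
have [N_eq0|N_neq0] := eqVneq N 0.
  apply: le_trans rhs0; rewrite big1// => k _.
  have := aN k; rewrite N_eq0 mulr0 => ak.
  by rewrite (_ : a k = 0) ?mul0r//; apply/eqP; rewrite eq_le ak a0.
have N_gt0 : 0 < N by rewrite lt_neqAle eq_sym N_neq0.
have b_gt0 : 0 < b by exact: lt_le_trans Nb.
set L := ln (b / N) in rhs0 *.
have bN : 1 <= b / N by rewrite ler_pdivlMr// mul1r.
have L0 : 0 <= L by exact: ln_ge0.
have NL : N = b * expR (- L).
  rewrite expRN lnK ?posrE ?divr_gt0// invf_div; field; exact: lt0r_neq0.
have L40 : 0 <= L / 4 by rewrite divr_ge0.
have /andP := truncn_itv L40; set m := Num.truncn _ => -[mL Lm].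
clearbody m L.
apply: (@le_trans _ _ (\sum_(k < K) ((if (k < m)%N then 3 ^+ k else 0) * (b * N)
    + a k / m.+1%:R ^+ 2))).
  apply: ler_sum => k _; case: ltnP => km.
    apply: ler_wpDr; first by rewrite divr_ge0// exprn_ge0.
    rewrite mulrA (le_trans _ (aN k))// ler_piMr// invf_le1 -natrM ?ltr0n//.
    by rewrite ler1n.
  rewrite mul0r add0r ler_wpM2l// lef_pV2 ?posrE ?exprn_gt0 ?mulr_gt0//.
  by rewrite expr2 -!natrM ler_nat leq_mul// ltnS leqW.
rewrite big_split/= -!mulr_suml.
apply: (@le_trans _ _ (3 ^+ m * (b * N) + b ^+ 2 / m.+1%:R ^+ 2)).
  apply: lerD; last by rewrite ler_wpM2r// invr_ge0 exprn_ge0.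
  apply: ler_wpM2r; first by apply: mulr_ge0 => //; exact: ltW.
  by apply: le_trans (sum_pow3_le K m) _; rewrite ler_weXn2l ?geq_minr// ler1n.
have b2 : 0 <= b ^+ 2 by exact: sqr_ge0.
have h1 : 3 ^+ m * (b * N) <= b ^+ 2 * (16 / (1 + L) ^+ 2).
  have -> : 3 ^+ m * (b * N) = b ^+ 2 * (3 ^+ m * expR (- L)).
    by rewrite NL; ring.
  by rewrite ler_wpM2l// pow3_decay.
have h2 : b ^+ 2 / m.+1%:R ^+ 2 <= b ^+ 2 * (25 / (1 + L) ^+ 2).
  rewrite ler_wpM2l// -[25](_ : 5 ^+ 2 = _ :> R); last by rewrite -natrX.
  rewrite -expr_div_n -exprVn lerXn2r ?nnegrE//.
    by rewrite divr_ge0// addr_ge0.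
  rewrite ler_pdivlMr ?ltr_pwDl// mulrC ler_pdivrMr ?ltr0n//.
  have : 1 <= m.+1%:R :> R by rewrite ler1n.
  by move: (m.+1%:R : R) Lm => M; lra.
apply: le_trans (lerD h1 h2) _; rewrite -mulrDr -mulrDl.
by rewrite le_eqVlt; apply/orP; left; apply/eqP; rewrite mulrCA; congr (_ * _); ring.
Qed.

End weights.

Section gauss_norms.
Context (R : realType) (n : nat).
Implicit Types (f g : 'rV[R]_n -> R).
Local Notation E f := (\int[gauss R n]_x f x).
Local Notation sqi := (sqintg (gauss R n)).

Lemma Lfun_sqintg f : f \in Lfun (gauss R n) 2%:E -> sqi f.
Proof.
move=> lf; split; last exact: Lfun2_integrable_sqr.
by have /sub_Lfun_mfun := lf; rewrite inE.
Qed.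

Lemma gauss_norm2E f : sqi f -> gauss_norm 2 f = Num.sqrt (E (fun x => f x ^+ 2)).
Proof.
move=> [mf jf]; rewrite /gauss_norm unlock.
rewrite (_ : (\int[_]_x _)%E = (E (fun x => f x ^+ 2))%:E).
  by rewrite poweR_EFin/= powR12_sqrt//; apply: E_ge0 => x; exact: sqr_ge0.
rewrite /Rintegral fineK; last exact: integrable_fin_num.
by apply: eq_integral => x _; rewrite /= powR_mulrn// real_normK// num_real.
Qed.

Lemma gauss_norm1E f : sqi f -> gauss_norm 1 f = E (fun x => `|f x|).
Proof. by move=> jf; rewrite /gauss_norm Lnorm1. Qed.

Lemma energy0E f : energy 0 f = (E f) ^+ 2.
Proof.
rewrite /energy big_seq1 fact0 invr1 mul1r /coef; congr (_ ^+ 2).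
by apply: eq_E => x; rewrite /= mulr1.
Qed.

(** The weights [1 / ((k + 1) (k + 2))] are those with which the energies of the
    second derivatives of a function recombine into its energy. *)
Lemma talagrand_energy K g : sqi g ->
  \sum_(k < K) energy k g / (k.+1%:R * k.+2%:R) <=
  41 * (gauss_norm 2 g ^+ 2 / (1 + ln (gauss_norm 2 g / gauss_norm 1 g)) ^+ 2).
Proof.
move=> jg; rewrite gauss_norm2E// gauss_norm1E//.
have g2 : 0 <= E (fun x => g x ^+ 2) by apply: E_ge0 => x; exact: sqr_ge0.
have g1 : 0 <= E (fun x => `|g x|) by exact: E_ge0.
apply: (@weighted_sum_bound _ (fun k => energy k g)).
- by move=> k; exact: energy_ge0.
- rewrite g1/= -(@ler_pXn2r _ 2)// ?nnegrE ?sqrtr_ge0// sqr_sqrtr//.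
  apply: le_trans (E_sqr_le (sqintg_norm jg)) _.
  rewrite le_eqVlt; apply/orP; left; apply/eqP/eq_E => x.
  by rewrite real_normK// num_real.
- by move=> k; exact: energy_low_degree.
- by rewrite sqr_sqrtr//; exact: bessel.
Qed.

End gauss_norms.

Theorem theorem11 (R : realType) :
  exists C : R, 0 < C /\
  forall (n : nat) (f : 'rV[R]_n -> R),
    (1 <= n)%N ->
    Ck 2 f ->
    f \in Lfun (gauss R n) 2%:E ->
    (forall i, partial i f \in Lfun (gauss R n) 2%:E) ->
    (forall i j, partial2 i j f \in Lfun (gauss R n) 2%:E) ->
    gauss_var f <=
      euclidean_norm (gauss_integral_rV (gradient f)) ^+ 2 +
      C * \sum_(i < n) \sum_(j < n)
        gauss_norm 2 (partial2 i j f) ^+ 2 /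
        (1 + ln (gauss_norm 2 (partial2 i j f) /
                 gauss_norm 1 (partial2 i j f))) ^+ 2.
Proof.
exists 41; split => // n f _ [_ c1f] lf ldf lddf.
have jf := Lfun_sqintg lf.
have jdf i := Lfun_sqintg (ldf i).
have jddf i j := Lfun_sqintg (lddf i j).
have lC1 i : line_C1 i f (partial i f).
  by have [df [cdf _]] := c1f i; exact: line_C1_derivable.
have lC2 i j : line_C1 i (partial j f) (partial2 i j f).
  by have [_ [_ /(_ i)[ddf [cddf _]]]] := c1f j; exact: line_C1_derivable.
have grad : euclidean_norm (gauss_integral_rV (gradient f)) ^+ 2 = energy 1 f.
  rewrite sqr_sqrtr; last by apply: sumr_ge0 => i _; exact: sqr_ge0.
  have := energy_partial 0 lC1 jf jdf; rewrite mul1r => <-.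
  apply: eq_bigr => i _; rewrite energy0E !mxE; congr (_ ^+ 2).
  by apply: eq_E => x; rewrite mxE.
have hess k : energy k.+2 f =
    \sum_i \sum_j energy k (partial2 i j f) / (k.+1%:R * k.+2%:R).
  have k1 : k.+1%:R != 0 :> R by rewrite pnatr_eq0.
  have k2 : k.+2%:R != 0 :> R by rewrite pnatr_eq0.
  rewrite exchange_big/=.
  under eq_bigr => j _.
    rewrite -mulr_suml (energy_partial k (lC2 ^~ j) (jdf j) (jddf ^~ j)).
    rewrite (_ : _ / _ = k.+2%:R^-1 * energy k.+1 (partial j f)); last first.
      by rewrite invfM mulrACA divff// mul1r mulrC.
    over.
  rewrite -mulr_sumr (energy_partial k.+1 lC1 jf jdf).
  by rewrite mulrA mulVf// mul1r.
apply/ler_addgt0Pr => e e0.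
have [p [pp fpe]] := polyfun_dense jf e0.
have [K fK] := energy_approx pp jf.
have fK2 : \int[gauss R n]_x (f x ^+ 2) <= \sum_(k < K.+2) energy k f + e.
  apply: le_trans fK (lerD _ (ltW fpe)).
  by rewrite 2!big_ord_recr/= -addrA lerDl addr_ge0// energy_ge0.
have split2 : \sum_(k < K.+2) energy k f = (\int[gauss R n]_x f x) ^+ 2 + energy 1 f +
    \sum_(k < K) energy k.+2 f.
  by rewrite 2!big_ord_recl/= energy0E addrA.
have tail : \sum_(k < K) energy k.+2 f <= 41 * \sum_(i < n) \sum_(j < n)
        gauss_norm 2 (partial2 i j f) ^+ 2 /
        (1 + ln (gauss_norm 2 (partial2 i j f) /
                 gauss_norm 1 (partial2 i j f))) ^+ 2.
  under eq_bigr do rewrite hess.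
  rewrite exchange_big/= mulr_sumr; apply: ler_sum => i _.
  rewrite exchange_big/= mulr_sumr; apply: ler_sum => j _.
  exact: talagrand_energy.
rewrite /gauss_var grad lerBlDr; apply: le_trans fK2 _.
rewrite split2; lra.
Qed.
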